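(* Fix $B>0$, let $2\le s^*\le d/2$, and write $H=s^*\log(ed/s^* )$ and $\ell_n=\log(en)$. Suppose $\lambda_{\max}\{\mathbb E(xx^\top)\}\le C$ and $\|\psi''\|_\infty\le c_2$. There are constants $c_0,c_1,c_2'>0$, depending only on these bounds, such that if $$0<\varepsilon\le1,\qquad 0\le\delta\le c_0\,\varepsilon\exp\{-c_1H/\sqrt{\ell_n}\},$$ and $$c(\sigma)\left\{\frac Hn+\frac{H^2}{\ell_nn^2\varepsilon^2}\right\}\le c_2'B^2,$$ then $$\inf_{M\in\mathcal M_{\varepsilon,\delta}}\ \sup_{\beta\in\Theta_{s^*}(B)}\mathbb E_\beta\|M(\mathbf Z)-\beta\|_2^2\ \ge\ c\,c(\sigma)\left\{\frac Hn+\frac{H^2}{\ell_nn^2\varepsilon^2}\right\},$$ where $c>0$ may depend only on the displayed covariance and curvature bounds ($C$, $c_2$) and on the fixed bounds for $c(\sigma)$, but not on $n,d,s^*,B,\varepsilon$, or $\delta$.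
   Context: Generalized linear model: $\mathbf Z=\{(y_i,x_i)\}_{i=1}^n$ is i.i.d. with $x\in\mathbb R^d$ of law $f_x$ and, given $x$, $y$ with density (with respect to a fixed dominating measure) $f_\beta(y\mid x)=h(y,\sigma)\exp\{(yx^\top\beta-\psi(x^\top\beta))/c(\sigma)\}$, where $\psi,h,c(\sigma)$ are fixed and known and, for every $\theta\in\mathbb R$, $h(y,\sigma)\exp\{(y\theta-\psi(\theta))/c(\sigma)\}$ is a probability density. The scale $c(\sigma)>0$ is a fixed constant bounded above and away from zero. Parameter space: $\Theta_s(B)=\{\beta\in\mathbb R^d:\|\beta\|_0\le s,\ \|\beta\|_2\le B\}$, where $\|\beta\|_0$ is the number of nonzero coordinates. Differential privacy: $M$ is $(\varepsilon,\delta)$-differentially private if for every two data sets $D,D'$ of size $n$ differing by replacement of one record and every measurable $S$, $\mathbb P(M(D)\in S)\le e^\varepsilon\mathbb P(M(D')\in S)+\delta$ (probability over $M$ only). $\mathcal M_{\varepsilon,\delta}$ is the class of all such algorithms with values in $\mathbb R^d$. $\mathbb E_\beta$ is over the data under $\beta$ and the randomness of $M$. *)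

(* Defs.v *)
From HB Require Import structures.
From mathcomp Require Import all_boot all_order all_algebra.
From mathcomp Require Import all_classical all_reals all_analysis.
From mathcomp Require Import measurable_realfun.

Set Implicit Arguments.
Unset Strict Implicit.
Unset Printing Implicit Defensive.

Import Order.TTheory GRing.Theory Num.Theory.
Import numFieldNormedType.Exports.

Local Open Scope classical_set_scope.
Local Open Scope ring_scope.

(* R^d is d.-tuple R, with the sigma-algebra generated by the coordinates (the
   Borel one); a record is a pair (y, x). *)
Notation record R d := (R * d.-tuple R)%type.

Section vectors.
Context {R : realType} {d : nat}.
Implicit Types (x b : d.-tuple R).

Definition dotv x b : R := \sum_(i < d) tnth x i * tnth b i.
Definition sqdist x b : R := \sum_(i < d) (tnth x i - tnth b i) ^+ 2.
Definition l0norm b : nat := #|[set i : 'I_d | tnth b i != 0]%SET|.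
Definition l2norm b : R := Num.sqrt (\sum_(i < d) tnth b i ^+ 2).

Definition sparse_ball (s : nat) (B : R) : set (d.-tuple R) :=
  [set b | (l0norm b <= s)%N /\ l2norm b <= B].

End vectors.

(* The set of eigenvalues is finite, and nonempty for A symmetric and d > 0,
   in which case the supremum is the largest eigenvalue. *)
Definition lambda_max {R : realType} {d : nat} (A : 'M[R]_d) : R :=
  sup [set a : R | eigenvalue A a].

Record glm (R : realType) (d : nat) := Glm {
  glm_mu : {sigma_finite_measure set R -> \bar R};
  glm_h : R -> R -> R;
  glm_psi : R -> R;
  glm_c : R -> R;
  glm_sigma : R;
  glm_fx : probability (d.-tuple R) R;
  glm_c_gt0 : 0 < glm_c glm_sigma;
  glm_h_ge0 : forall y, 0 <= glm_h y glm_sigma;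
  glm_h_measurable : measurable_fun [set: R] (glm_h ^~ glm_sigma);
  glm_psi_derivable : forall t, derivable glm_psi t 1;
  glm_dpsi_derivable : forall t, derivable (derive1 glm_psi) t 1;
  glm_density_mass1 : forall theta : R,
    (\int[glm_mu]_y (glm_h y glm_sigma *
       expR ((y * theta - glm_psi theta) / glm_c glm_sigma))%:E = 1)%E
}.

Section glm_law.
Context {R : realType} {d : nat} (m : glm R d).

Definition glm_scale : R := glm_c m (glm_sigma m).

Definition glm_density (b : d.-tuple R) (z : record R d) : R :=
  glm_h m z.1 (glm_sigma m) *
  expR ((z.1 * dotv z.2 b - glm_psi m (dotv z.2 b)) / glm_scale).

(* Law of one record under b: x has law f_x and, given x, y has density
   f_b(y | x) with respect to mu. *)
Definition glm_law (b : d.-tuple R) (A : set (record R d)) : \bar R :=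
  (\int[glm_mu m \x glm_fx m]_(z in A) (glm_density b z)%:E)%E.

Lemma glm_density_ge0 b z : 0 <= glm_density b z.
Proof. by rewrite mulr_ge0 ?glm_h_ge0 ?expR_ge0. Qed.

Lemma measurable_dotv (b : d.-tuple R) :
  measurable_fun [set: d.-tuple R] (dotv ^~ b).
Proof.
apply: measurable_sum => i; apply: measurable_funM => //.
exact: measurable_tnth.
Qed.

Lemma measurable_glm_psi :
  measurable_fun [set: R] (glm_psi m).
Proof.
apply: continuous_measurable_fun => t.
exact/differentiable_continuous/derivable1_diffP/glm_psi_derivable.
Qed.

Lemma measurable_glm_density b :
  measurable_fun [set: record R d] (glm_density b).
Proof.
have mdot : measurable_fun [set: record R d]
    (fun z : record R d => dotv z.2 b).
  exact: (measurableT_comp (measurable_dotv b) measurable_snd).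
apply: measurable_funM.
  exact: (measurableT_comp (glm_h_measurable m) measurable_fst).
apply: (measurableT_comp (@measurable_expR R)).
apply: measurable_funM => //; apply: measurable_funB.
  exact: measurable_funM.
exact: (measurableT_comp measurable_glm_psi mdot).
Qed.

Lemma measurable_glm_densityE b :
  measurable_fun [set: record R d] (fun z => (glm_density b z)%:E).
Proof. by apply/measurable_EFinP; exact: measurable_glm_density. Qed.

Let glm_law0 b : glm_law b set0 = 0%E.
Proof. exact: integral_set0. Qed.

Let glm_law_ge0 b A : (0 <= glm_law b A)%E.
Proof. by apply: integral_ge0 => z _; rewrite lee_fin glm_density_ge0. Qed.

Let glm_law_sigma_additive b : semi_sigma_additive (glm_law b).
Proof.
move=> F mF tF mUF; rewrite /glm_law ge0_integral_bigcup//=; last 2 first.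
- exact: measurable_funTS (measurable_glm_densityE b).
- by move=> z _; rewrite lee_fin glm_density_ge0.
apply: is_cvg_ereal_nneg_natsum_cond => n _ _; exact: glm_law_ge0.
Qed.

HB.instance Definition _ b := isMeasure.Build _ _ _ (glm_law b)
  (glm_law0 b) (glm_law_ge0 b) (@glm_law_sigma_additive b).

Let glm_lawT b : glm_law b [set: record R d] = 1%E.
Proof.
rewrite /glm_law fubini_tonelli2; last 2 first.
- exact: measurable_glm_densityE.
- by move=> z; rewrite lee_fin glm_density_ge0.
rewrite (eq_integral (cst 1%E)); last first.
  by move=> x _; exact: (glm_density_mass1 m (dotv x b)).
by rewrite integral_cst// mul1e; exact: probability_setT.
Qed.

HB.instance Definition _ b :=
  Measure_isProbability.Build _ _ _ (glm_law b) (glm_lawT b).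

(* The matrix E(x x^T). *)
Definition glm_gram : 'M[R]_d :=
  \matrix_(i, j) (\int[glm_fx m]_x (tnth x i * tnth x j))%R.

Definition glm_gram_exists : Prop := forall i j : 'I_d,
  (glm_fx m).-integrable [set: d.-tuple R]
    (fun x => (tnth x i * tnth x j)%:E).

End glm_law.

Section iid.
Context {disp : measure_display} {T : measurableType disp} {R : realType}.

Definition cons_pair n (z : T * n.-tuple T) : n.+1.-tuple T :=
  [the n.+1.-tuple T of z.1 :: z.2].

Let measurable_cons_pair n :
  measurable_fun [set: T * n.-tuple T] (@cons_pair n).
Proof. exact: measurable_cons. Qed.

HB.instance Definition _ n :=
  isMeasurableFun.Build _ _ _ _ (@cons_pair n) (@measurable_cons_pair n).

(* The n-fold product of P. *)
Fixpoint iid (P : probability T R) (n : nat) : probability (n.-tuple T) R :=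
  if n is k.+1 return probability (n.-tuple T) R
  then distribution (P \x iid P k)%E (@cons_pair k)
  else dirac [tuple].

End iid.

Section privacy.
Context {R : realType} {n d : nat}.

(* A randomized algorithm is a Markov kernel from data sets to R^d. *)
Notation algorithm := (R.-pker (n.-tuple (record R d)) ~> d.-tuple R).

Definition neighbors (D D' : n.-tuple (record R d)) : Prop :=
  exists i : 'I_n, forall j : 'I_n, j != i -> tnth D j = tnth D' j.

Definition dp (eps delta : R) : set algorithm :=
  [set M : algorithm | forall D D', neighbors D D' ->
     forall S : set (d.-tuple R), measurable S ->
     (M D S <= (expR eps)%:E * M D' S + delta%:E)%E].

Definition risk (m : glm R d) (M : algorithm) (b : d.-tuple R) : \bar R :=
  (\int[iid (glm_law m b) n]_D \int[M D]_t (sqdist t b)%:E)%E.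

Definition minimax_risk (m : glm R d) (eps delta : R) (Theta : set (d.-tuple R))
    : \bar R :=
  ereal_inf [set ereal_sup [set risk m M b | b in Theta] | M in dp eps delta].

End privacy.

Arguments minimax_risk {R} n {d} m eps delta Theta.

Section rate.
Context {R : realType}.

(* H, ell_n, and H / n + H^2 / (ell_n n^2 eps^2) *)
Definition entropy (d s : nat) : R :=
  s%:R * ln (expR 1 * d%:R / s%:R).

Definition log_en (n : nat) : R := ln (expR 1 * n%:R).

Definition dp_rate (n d s : nat) (eps : R) : R :=
  entropy d s / n%:R +
  entropy d s ^+ 2 / (log_en n * n%:R ^+ 2 * eps ^+ 2).

End rate.

(* Main.v *)
Require Import Defs.
From mathcomp Require Import all_boot all_order all_algebra.
From mathcomp Require Import all_classical all_reals all_analysis.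
From mathcomp Require Import measurable_realfun.
From mathcomp Require Import ring lra.

(** Cut [s * q] of the [d] coordinates, [q = d %/ s], into [s] blocks of size
    [q], and let the vertices be the [s]-sparse vectors of norm [rho] with one
    constant nonzero entry in each block. There are [N = q ^ s] of them, with
    [N ^ 4 >= exp H]. Two vertices are at a squared distance proportional to the
    number of blocks on which they differ, so a ball of squared radius
    [rho ^ 2 / 24] around any point contains at most [N ^ (5 / 6)] vertices
    ([card_cube_ball]): no separated subfamily has to be extracted.

    Consequently, under the law of the data for the parameter [0], the probability
    that the estimate falls near vertex [v] is on average over [v] at most
    [N ^ (- 1 / 6)]. If replacing the parameter [0] by [v] increases these
    probabilities by a small power of [N] and a small additive term only, some
    vertex is missed with constant probability and has risk of order [rho ^ 2]
    ([missed_vertex]). Only the comparison of the laws for [0] and [v] differs for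
    the two terms of the rate, and in both cases it is made for one record first
    and then carried to [n] records by induction, integrating the records out one
    at a time.

    For the term [H / n], the likelihood ratio of one record has, given the
    covariate [x], second moment at most [exp (c2 (x . v) ^ 2 / c)], by the bound
    on the second difference of [psi]. With second moments of [x] only, this may
    not be integrable; multiplying the likelihood ratio by
    [exp (- c2 (x . v) ^ 2 / (2 c))] makes it so ([glm_weighted_l2]). By
    Cauchy-Schwarz the weighted probabilities are at most the square roots of the
    null ones, and by Markov's inequality the product of the [n] weights is rarely
    below a small power of [1 / N] when [n rho ^ 2 / c] is a small multiple of [H]
    ([weighted_l2_change_of_law]).

    For the private term, the laws of one record for [0] and [v] are at total
    variation distance [t] of order [rho / sqrt c] ([glm_tv_le]). The probability
    that a private algorithm lands in a given set varies by a factor [exp eps] at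
    most, up to [delta], when a record is changed; averaging over that record, it
    changes by a factor [1 + (exp eps - 1) t] when the law of the record is changed
    ([tv_private_step]). Over [n] records the factor is at most [exp (4 n eps t)],
    and [rho] is chosen so that [n eps t] is a small multiple of [H / sqrt l] with
    [l = log (e n)]. This is at most [H] and yields the rate; it also is the scale
    at which the accumulated [delta] is absorbed by the hypothesis on [delta].

    The covariance bound enters through [E (x . v) ^ 2 <= C rho ^ 2]
    ([integral_dotv_sqr_le]). *)

Set Implicit Arguments.
Unset Strict Implicit.
Unset Printing Implicit Defensive.

Import Order.TTheory GRing.Theory Num.Theory.
Import numFieldNormedType.Exports.

Local Open Scope classical_set_scope.
Local Open Scope ring_scope.

(** * The blockwise hypercube of sparse vectors *)

Section hypercube.
Context {R : realType} {d s q : nat} (sq_le_d : (s * q <= d)%N) (rho : R).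
Implicit Types (v w : {ffun 'I_s -> 'I_q}) (t : d.-tuple R).

Definition block_index (j : 'I_s) (k : 'I_q) : 'I_d :=
  widen_ord sq_le_d (mxvec_index j k).

Lemma block_index_inj j j' k k' :
  block_index j k = block_index j' k' -> (j, k) = (j', k').
Proof.
move=> /(congr1 val)/= eq_val.
have /val_inj eq_index : val (mxvec_index j k) = val (mxvec_index j' k') by [].
case: (curry_mxvec_bij s q) => g gK _.
by rewrite -(gK (j, k))// -(gK (j', k'))//= eq_index.
Qed.

Definition cube_support v : {set 'I_d} :=
  [set block_index j (v j) | j : 'I_s]%SET.

Definition cube_vertex v : d.-tuple R :=
  [tuple if i \in cube_support v then rho / Num.sqrt s%:R else 0 | i < d].

Definition hamming v w : nat := #|[set j | v j != w j]%SET|.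

Lemma mem_cube_support v j k : (block_index j k \in cube_support v) = (v j == k).
Proof.
apply/imsetP/eqP => [[j' _ /block_index_inj[<- ->//]]|<-].
by exists j.
Qed.

Lemma card_cube_support v : #|cube_support v| = s.
Proof.
by rewrite card_imset ?card_ord// => j j' /block_index_inj[].
Qed.

Lemma l0norm_cube_vertex v : (l0norm (cube_vertex v) <= s)%N.
Proof.
rewrite -[leqRHS](card_cube_support v); apply/subset_leq_card/fintype.subsetP => i.
by rewrite inE tnth_mktuple; case: ifP => //; rewrite eqxx.
Qed.

Lemma sum_cube_vertex_sqr v : (0 < s)%N ->
  \sum_(i < d) tnth (cube_vertex v) i ^+ 2 = rho ^+ 2.
Proof.
move=> s0; under eq_bigr do rewrite tnth_mktuple.
rewrite (bigID [in cube_support v])/= [X in _ + X]big1 ?addr0; last first.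
  by move=> i /negbTE ->; rewrite expr0n.
under eq_bigr do rewrite ifT//.
rewrite sumr_const card_cube_support expr_div_n sqr_sqrtr ?ler0n//.
by rewrite -[LHS]mulr_natr divfK// pnatr_eq0 -lt0n.
Qed.

Lemma l2norm_cube_vertex v : (0 < s)%N -> 0 <= rho ->
  l2norm (cube_vertex v) = rho.
Proof. by move=> s0 r0; rewrite /l2norm sum_cube_vertex_sqr// sqrtr_sqr ger0_norm. Qed.

(** A coordinate in the support of [v] but not of [w] costs
    [rho ^+ 2 / s], and each block on which [v] and [w] differ has one. *)
Lemma hamming_sqdist t v w :
  rho ^+ 2 / s%:R * (hamming v w)%:R
    <= 2 * (sqdist t (cube_vertex v) + sqdist t (cube_vertex w)).
Proof.
rewrite /sqdist -big_split/= mulr_sumr.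
pose D := [set block_index j (v j) | j in [set j | v j != w j]%SET]%SET.
have cD : #|D| = hamming v w.
  by rewrite card_imset// => j j' /block_index_inj[].
rewrite (bigID [in D])/= -[leLHS]addr0 lerD//; last first.
  by apply: sumr_ge0 => i _; rewrite mulr_ge0// addr_ge0// sqr_ge0.
rewrite -cD mulr_natr -sumr_const; apply: ler_sum => i /imsetP[j].
rewrite inE => vw ->; rewrite !tnth_mktuple !mem_cube_support eqxx eq_sym (negbTE vw) subr0.
set x := tnth t _; set a := rho / _.
have -> : rho ^+ 2 / s%:R = a ^+ 2 by rewrite expr_div_n sqr_sqrtr.
have := sqr_ge0 (2 * x - a); rewrite -subr_ge0; lra.
Qed.

(** The blocks are chosen independently, so the generating function of the
    Hamming distance is a product. *)
Lemma sum_expr_hamming w (y : R) :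
  \sum_v y ^+ hamming v w = (1 + q.-1%:R * y) ^+ s.
Proof.
have E v : y ^+ hamming v w = \prod_(j < s) (if v j == w j then 1 else y).
  rewrite (bigID (fun j => v j == w j))/= big1 ?mul1r; last by move=> j ->.
  under eq_bigr => j /negbTE -> do [].
  by rewrite prodr_const /hamming cardsE.
under eq_bigr do rewrite E.
rewrite -(bigA_distr_bigA (fun j k => if k == w j then 1 else y)).
rewrite (eq_bigr (fun _ => 1 + q.-1%:R * y)) ?prodr_const ?card_ord// => j _.
rewrite (bigD1 (w j))//= eqxx; congr (_ + _).
under eq_bigr => k /negbTE -> do [].
by rewrite sumr_const cardC1 card_ord mulr_natl.
Qed.

End hypercube.

(** The cubed form of [(2 q - 1) / q ^ 2 <= q ^ (- 1 / 3)], which keeps an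
    exponential gain even for the smallest block size [q = 2]. *)
Lemma cube_le_exp5 (q : nat) : (2 <= q)%N -> ((2 * q - 1) ^ 3 <= q ^ 5)%N.
Proof.
case: q => [|[|[|q]]]// _.
apply: (@leq_trans ((2 * q.+3) ^ 3)); first by rewrite leq_exp2r// leq_subr.
rewrite expnMn -[5%N]/(2 + 3)%N expnD leq_mul2r; apply/orP; right.
by rewrite (@leq_trans (3 ^ 2))// leq_exp2r.
Qed.

(** All vertices in the ball are within Hamming distance [s / 6] of any one of
    them; they are counted by the exponential Markov inequality, that is the
    generating function at [1 / q]. *)
Lemma card_cube_ball (R : realType) (d s q : nat) (sq_le_d : (s * q <= d)%N)
    (rho : R) (t : d.-tuple R) :
  (0 < s)%N -> (2 <= q)%N -> 0 < rho ->
  (#|[set v : {ffun 'I_s -> 'I_q} |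
       sqdist t (cube_vertex sq_le_d rho v) < rho ^+ 2 / 24]%SET|%:R : R)
  <= #|{ffun 'I_s -> 'I_q}|%:R * expR (- (s%:R * ln q%:R / 6)).
Proof.
move=> s0 q2 rho0; set A := [set v | _]%SET.
have q1 : (0 < q)%N by exact: ltnW.
have q0 : (0 < q%:R :> R) by rewrite ltr0n.
have [->|[w wA]] := set_0Vmem A.
  by rewrite cards0 mulr_ge0// expR_ge0.
set l : R := ln q%:R.
have l0 : 0 <= l by rewrite ln_ge0// ler1n.
have ql : q%:R = expR l by rewrite lnK// posrE.
have s0R : 0 < s%:R :> R by rewrite ltr0n.
have hA v : v \in A -> (hamming v w)%:R <= s%:R / 6 :> R.
  move=> vA; have := hamming_sqdist sq_le_d rho t v w.
  move: vA wA; rewrite !inE => vA wA H.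
  have {}H : rho ^+ 2 / s%:R * (hamming v w)%:R <= rho ^+ 2 / s%:R * (s%:R / 6).
    apply: (le_trans H); rewrite mulrA mulfVK ?gt_eqF//; lra.
  by move: H; rewrite ler_pM2l// divr_gt0// exprn_gt0.
have step : (#|A|%:R : R) * expR (- (s%:R * l / 6)) <= (1 + q.-1%:R * expR (- l)) ^+ s.
  rewrite -(sum_expr_hamming w (expR (- l))) (bigID [in A])/= -[leLHS]addr0 lerD//; last first.
    by apply: sumr_ge0 => v _; rewrite exprn_ge0// expR_ge0.
  rewrite mulr_natl -sumr_const; apply: ler_sum => v vA.
  rewrite -expRM_natl ler_expR mulrN lerN2 mulrAC ler_wpM2r// hA//.
have base : 1 + q.-1%:R * expR (- l) <= q%:R * expR (- (l / 3)).
  have e5 : (2 * q - 1)%N%:R ^+ 3 <= q%:R ^+ 5 :> R.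
    by rewrite -!natrX ler_nat cube_le_exp5.
  have -> : 1 + q.-1%:R * expR (- l) = (2 * q - 1)%N%:R * expR (- l).
    rewrite expRN -ql natrB ?natrM; last by rewrite muln_gt0.
    rewrite -subn1 natrB;last by [].
    by field; rewrite gt_eqF.
  rewrite -(@ler_pXn2r _ 3)// ?nnegrE ?mulr_ge0 ?expR_ge0//.
  rewrite !exprMn -!expRM_natl ql -expRM_natl -expRD.
  apply: (@le_trans _ _ (expR (5 * l) * expR (3 * - l))).
    by rewrite ler_wpM2r ?expR_ge0//; rewrite ql -expRM_natl in e5.
  by rewrite -expRD ler_expR; lra.
have -> : expR (- (s%:R * l / 6)) = expR (- (s%:R * l / 3)) * expR (s%:R * l / 6).
  by rewrite -expRD; congr expR; lra.
rewrite mulrA -ler_pdivrMr ?expR_gt0// -expRN (le_trans step)//.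
rewrite card_ffun !card_ord natrX.
have -> : expR (- (s%:R * l / 3)) = expR (- (l / 3)) ^+ s.
  by rewrite -expRM_natl; congr expR; lra.
by rewrite -exprMn lerXn2r// nnegrE ?addr_ge0 ?mulr_ge0 ?expR_ge0.
Qed.

(** With [q = d %/ s] the number of vertices [q ^ s] is at least the fourth root
    of [(e d / s) ^ s], since [e (q + 1) <= q ^ 4]. *)
Lemma entropy_le (R : realType) (d s : nat) : (2 <= s)%N -> (2 * s <= d)%N ->
  entropy d s <= 4 * (s%:R * ln (d %/ s)%:R) :> R.
Proof.
move=> s2 sd; have s0 : (0 < s)%N by case: s s2 sd.
set q := (d %/ s)%N.
have q2 : (2 <= q)%N by rewrite leq_divRL.
have q0 : (0 < q%:R :> R) by rewrite ltr0n; case: q q2.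
have s0R : 0 < s%:R :> R by rewrite ltr0n.
rewrite /entropy mulrCA ler_pM2l// mulr_natl -lnXn//.
have dq : d%:R / s%:R <= (q.+1)%:R :> R.
  by rewrite ler_pdivrMr// -natrM ler_nat ltnW// ltn_ceil.
have d0 : (0 < d)%N by rewrite (leq_trans _ sd)// muln_gt0.
rewrite ler_ln ?posrE ?exprn_gt0// ?divr_gt0 ?mulr_gt0 ?expR_gt0 ?ltr0n//.
have e4 : expR 1 <= 4 :> R.
  rewrite [X in expR X](_ : _ = 2%:R * 2^-1); last by rewrite mulfV// pnatr_eq0.
  have -> : (4 : R) = 2 ^+ 2 by rewrite -natrX.
  rewrite expRM_natl lerXn2r ?nnegrE ?expR_ge0//.
  rewrite -[2^-1]opprK expRN invf_ple ?posrE ?expR_gt0//.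
  by apply: le_trans (expR_ge1Dx _); lra.
rewrite -mulrA; apply: (@le_trans _ _ (4 * q.+1%:R)).
  by rewrite ler_pM ?expR_ge0 ?divr_ge0.
rewrite -natrM -natrX ler_nat (@leq_trans (4 * (2 * q)))//.
  by rewrite leq_mul// mul2n -addnn -[q.+1]addn1 leq_add// ltnW.
by rewrite mulnA expnSr leq_mul// (@leq_trans (2 ^ 3))// leq_exp2r.
Qed.

(** * Second differences of the cumulant function *)

Lemma mean_value (R : realType) (f df : R -> R) :
  (forall t : R, is_derive t (1 : R) f (df t)) -> forall a b : R,
  exists2 c, 0 <= (c - a) * (b - c) & f b - f a = df c * (b - a).
Proof.
move=> fdf.
have H a b : a <= b -> exists2 c, 0 <= (c - a) * (b - c) & f b - f a = df c * (b - a).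
  move=> ab; have [|c] := @MVT_segment R f df a b ab (fun x _ => fdf x).
    by apply: derivable_within_continuous => x _; have [] := fdf x.
  rewrite in_itv/= => /andP[ac cb] E; exists c => //.
  by rewrite mulr_ge0 ?subr_ge0.
move=> a b; have [/H//|/ltW/H[c c0 E]] := leP a b.
by exists c; [lra|rewrite -[LHS]opprB E; ring].
Qed.

(** The second difference at [0] and [2 u] is bounded by the curvature: the
    derivative of [c2 u ^ 2 - f (2 u) + 2 f u] has the sign of [u]. *)
Lemma second_difference_le (R : realType) (f df ddf : R -> R) (c2 : R) :
  (forall t : R, is_derive t (1 : R) f (df t)) ->
  (forall t : R, is_derive t (1 : R) df (ddf t)) ->
  (forall t, `|ddf t| <= c2) ->
  forall u, f (2 * u) - 2 * f u + f 0 <= c2 * u ^+ 2.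
Proof.
move=> f' f'' le_c2 u.
pose g (t : R) := c2 * t ^+ 2 - f (2 * t) + 2 * f t.
pose dg t := 2 * (c2 * t - df (2 * t) + df t).
have g' (t : R) : is_derive t (1 : R) g (dg t).
  have h : is_derive t (1 : R) (fun t : R => 2 * t) 2.
    by apply: is_derive_eq; rewrite /GRing.scale/=; ring.
  have k : is_derive t (1 : R) (fun t => f (2 * t)) (df (2 * t) * 2).
    exact: (@is_derive1_comp R f (fun t => 2 * t)).
  rewrite /g; apply: is_derive_eq; rewrite /dg /GRing.scale/=; ring.
have dg0 c : 0 <= dg c * c.
  have [e _ E] := mean_value f'' c (2 * c).
  have -> : dg c * c = 2 * (c2 * c ^+ 2 - (df (2 * c) - df c) * c).
    by rewrite /dg; ring.
  rewrite E mulr_ge0// subr_ge0 (_ : _ * c = ddf e * c ^+ 2); last by ring.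
  by rewrite ler_wpM2r ?sqr_ge0// (le_trans (ler_norm _)).
have [c cu E] := mean_value g' 0 u.
suff : 0 <= g u - g 0 by rewrite /g !mulr0 expr0n/= mulr0; lra.
rewrite E subr0; have [c0|c0] := eqVneq c 0.
  have -> : dg c = 0 by rewrite c0 /dg !mulr0; ring.
  by rewrite mul0r.
have c2p : 0 < c ^+ 2 by rewrite exprn_even_gt0.
rewrite -(pmulr_lge0 _ c2p) (_ : dg c * u * c ^+ 2 = (dg c * c) * (c * u)); last by ring.
by rewrite mulr_ge0// (le_trans (ltW c2p))// -subr_ge0; move: cu; rewrite subr0 mulrBr expr2.
Qed.

(** * The largest eigenvalue of the Gram matrix *)

(** A maximizer of the Rayleigh quotient over the unit sphere, which is compact,
    is an eigenvector: the form [lambda |v|^2 - v A v^T] is nonnegative and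
    vanishes at the maximizer, hence so does its gradient there. *)
Lemma quad_form_le_lambda_max (R : realType) (d : nat) (A : 'M[R]_d) (v : 'rV[R]_d) :
  A^T = A ->
  (v *m A *m v^T) 0 0 <= lambda_max A * (v *m v^T) 0 0.
Proof.
move=> symA.
pose q (u : 'rV[R]_d) : R := (u *m A *m u^T) 0 0.
pose N (u : 'rV[R]_d) : R := (u *m u^T) 0 0.
have NE u : N u = \sum_i u 0 i ^+ 2.
  by rewrite /N mxE; apply: eq_bigr => i _; rewrite mxE expr2.
have N0 u : 0 <= N u by rewrite NE sumr_ge0// => i _; rewrite sqr_ge0.
have N_eq0 u : N u = 0 -> u = 0.
  rewrite NE => /eqP; rewrite psumr_eq0; last by move=> i _; rewrite sqr_ge0.
  move=> /allP u0; apply/rowP => i; rewrite mxE.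
  by have := u0 i (mem_index_enum i); rewrite sqrf_eq0 => /eqP.
have qZ a u : q (a *: u) = a ^+ 2 * q u.
  by rewrite /q linearZ/= -!scalemxAl -scalemxAr !mxE mulrA expr2.
have NZ a u : N (a *: u) = a ^+ 2 * N u.
  by rewrite /N linearZ/= -!scalemxAl -scalemxAr !mxE mulrA expr2.
have [->|v0] := eqVneq v 0; first by rewrite !mul0mx !mxE mulr0.
pose S : set 'rV[R]_d := [set u | N u = 1].
have normS u : N u != 0 -> S ((Num.sqrt (N u))^-1 *: u).
  move=> Nu0; rewrite /S/= NZ exprVn sqr_sqrtr// mulVf//.
have Nv0 : N v != 0 by apply: contra_neq v0 => /N_eq0.
have contc i : continuous (fun u : 'rV[R]_d => u 0 i).
  by move=> u; exact: coord_continuous.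
have contN : continuous N.
  have -> : N = fun u => \sum_i u 0 i ^+ 2 by apply/funext.
  apply: continuous_big => [|i _]; first exact: add_continuous.
  by move=> u; apply: continuousM; exact: contc.
have contq : continuous q.
  have -> : q = fun u => \sum_j (\sum_i u 0 i * A i j) * u 0 j.
    by apply/funext => u; rewrite /q mxE; apply: eq_bigr => j _; rewrite !mxE.
  apply: continuous_big => [|j _]; first exact: add_continuous.
  move=> u; apply: continuousM; last exact: contc.
  move: u; apply: continuous_big => [|i _]; first exact: add_continuous.
  by move=> u; apply: continuousM; [exact: contc|exact: cst_continuous].
have cS : compact S.
  apply: bounded_closed_compact.
    exists 1; split=> // M M1 u Su; apply: (le_trans _ (ltW M1)).
    rewrite [leLHS]/Num.norm/= mx_normrE; apply: bigmax_le => // -[i j] _ /=.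
    rewrite ord1 -(@ler_pXn2r _ 2)// ?nnegrE// real_normK ?num_real// expr1n.
    rewrite -Su NE (bigD1 j)//= lerDl sumr_ge0// => k _; exact: sqr_ge0.
  have -> : S = N @^-1` [set 1] by [].
  by apply: closed_comp => [u _|]; [exact: contN|exact: closed_eq].
have [w /set_mem Nw maxw] := compact_EVT_max (ex_intro S _ (normS v Nv0)) cS (continuous_subspaceT contq).
set l := q w.
have ql u : q u <= l * N u.
  have [/N_eq0 ->|Nu0] := eqVneq (N u) 0.
    by rewrite /q /N !mul0mx !mxE mulr0.
  have := maxw _ (mem_set (normS u Nu0)).
  by rewrite qZ exprVn sqr_sqrtr// mulrC ler_pdivrMr// lt_def Nu0 N0.
have eig a : eigenvalue A a -> a <= l.
  move=> /eigenvalueP[u uA u0].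
  have Nu0 : N u != 0 by apply: contra_neq u0 => /N_eq0.
  have := ql u; rewrite /q uA -scalemxAl mxE -/(N u) ler_pM2r//.
  by rewrite lt_def Nu0 N0.
suff ew : eigenvalue A l.
  have -> : lambda_max A = l.
    apply/eqP; rewrite eq_le; apply/andP; split.
      by apply: ge_sup; [exists l|move=> a /eig].
    by apply: ub_le_sup => //; exists l => a /eig.
  exact: ql.
apply/eigenvalueP; exists w; last first.
  apply/eqP => w0; move: Nw; rewrite /S/= w0 /N mul0mx mxE => /eqP.
  by rewrite eq_sym oner_eq0.
pose r := l *: w - w *m A.
pose P u := l * N u - q u.
have P0 u : 0 <= P u by rewrite subr_ge0.
(* The residual r is half the gradient of P at w; were it nonzero, P would
   become negative at a small step from w along - r. *)
have Pexp (e : R) : P (w + e *: r) = 2 * e * N r + e ^+ 2 * P r.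
  pose b (x y : 'rV[R]_d) : R := (x *m A *m y^T) 0 0.
  pose c (x y : 'rV[R]_d) : R := (x *m y^T) 0 0.
  have bC x y : b x y = b y x.
    rewrite /b (_ : x *m A *m y^T = (y *m A *m x^T)^T) ?mxE//.
    by rewrite !trmx_mul trmxK symA mulmxA.
  have cC x y : c x y = c y x.
    by rewrite /c (_ : x *m y^T = (y *m x^T)^T) ?mxE// trmx_mul trmxK.
  have trE (y : 'rV[R]_d) : (w + e *: y)^T = w^T + e *: y^T by apply/matrixP => i j; rewrite !mxE.
  have addE (X Y : 'M[R]_1) : (X + Y) 0 0 = X 0 0 + Y 0 0 by rewrite mxE.
  have sclE a (X : 'M[R]_1) : (a *: X) 0 0 = a * X 0 0 by rewrite mxE.
  have subE (X Y : 'M[R]_1) : (X - Y) 0 0 = X 0 0 - Y 0 0 by rewrite !mxE.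
  have qE y : q (w + e *: y) = q w + 2 * e * b w y + e ^+ 2 * q y.
    rewrite /q trE !mulmxDl !mulmxDr -!scalemxAl -!scalemxAr !(addE, sclE).
    rewrite -/(b w w) -/(b w y) -/(b y w) -/(b y y) (bC y w) -/(q w) -/(q y); ring.
  have NwrE y : N (w + e *: y) = N w + 2 * e * c w y + e ^+ 2 * N y.
    rewrite /N trE !mulmxDl !mulmxDr -!scalemxAl -!scalemxAr !(addE, sclE).
    rewrite -/(c w w) -/(c w y) -/(c y w) -/(c y y) (cC y w); ring.
  have crr : N r = l * c w r - b w r.
    by rewrite /N {1}/r mulmxBl -scalemxAl subE sclE.
  rewrite /P qE NwrE crr Nw -/l; ring.
suff : N r = 0 by move=> /N_eq0 /eqP; rewrite subr_eq0 => /eqP.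
apply/eqP; rewrite eq_le N0 andbT leNgt; apply/negP => Nr0.
pose D := 1 + P r.
have D0 : 0 < D by rewrite ltr_pwDl.
have := P0 (w + (- (N r / D)) *: r); rewrite Pexp.
have -> : 2 * - (N r / D) * N r + (- (N r / D)) ^+ 2 * P r =
    - (N r / D) ^+ 2 * (D + 1).
  by rewrite /D; field; rewrite -/D gt_eqF.
by rewrite leNgt mulNr oppr_lt0 mulr_gt0// ?exprn_gt0 ?divr_gt0// addr_gt0.
Qed.

(** The left side is the quadratic form of the Gram matrix at [b]. *)
Lemma integral_dotv_sqr_le (R : realType) (d : nat) (m : glm R d) (b : d.-tuple R) :
  glm_gram_exists m ->
  (\int[glm_fx m]_x ((dotv x b) ^+ 2)%:E
    <= (lambda_max (glm_gram m) * \sum_(i < d) tnth b i ^+ 2)%:E)%E.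
Proof.
move=> gram.
pose v : 'rV[R]_d := \row_i tnth b i.
have symA : (glm_gram m)^T = glm_gram m.
  by apply/matrixP => i j; rewrite !mxE; apply: eq_Rintegral => x _; rewrite mulrC.
have := quad_form_le_lambda_max v symA.
have -> : (v *m v^T) 0 0 = \sum_(i < d) tnth b i ^+ 2.
  by rewrite mxE; apply: eq_bigr => i _; rewrite !mxE expr2.
move=> le_q; apply: (@le_trans _ _ ((v *m glm_gram m *m v^T) 0 0)%:E); last by rewrite lee_fin.
have dE x : ((dotv x b) ^+ 2)%:E = (\sum_(j < d) \sum_(i < d)
     (tnth b i * tnth b j)%:E * (tnth x i * tnth x j)%:E)%E.
  rewrite expr2 {2}/dotv mulr_sumr -sumEFin; apply: eq_bigr => j _.
  rewrite /dotv mulr_suml -sumEFin; apply: eq_bigr => i _.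
  by rewrite -EFinM; congr EFin; ring.
under eq_integral do rewrite dE.
have int i j : (glm_fx m).-integrable setT
    (fun x => ((tnth b i * tnth b j)%:E * (tnth x i * tnth x j)%:E)%E).
  by apply: integrableZl.
rewrite integral_sum//; last by move=> j; apply: integrable_sum => // i _; exact: int.
rewrite mxE -sumEFin; apply: lee_sum => j _.
rewrite integral_sum//.
rewrite !mxE mulr_suml -sumEFin; apply: lee_sum => i _.
rewrite integralZl//.
rewrite !mxE -[X in (_ * X)%E]fineK; last exact: (integrable_fin_num _ (gram i j)).
by rewrite -EFinM lee_fin /Rintegral le_eqVlt; apply/orP; left; apply/eqP; ring.
Qed.

(** * Integration against densities and product laws *)

Section density.
Import HBNNSimple.

(** Both sides are monotone limits of their values on simple functions. *)
Lemma ge0_integral_density d (T : measurableType d) (R : realType)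
    (mu P : {measure set T -> \bar R}) (p : T -> R) (f : T -> \bar R) :
  (forall x, 0 <= p x) -> measurable_fun setT p ->
  (forall A, measurable A -> P A = \int[mu]_(x in A) (p x)%:E)%E ->
  (forall x, 0 <= f x)%E -> measurable_fun setT f ->
  (\int[P]_x f x = \int[mu]_x (f x * (p x)%:E))%E.
Proof.
move=> p0 mp PE f0 mf.
have mpE : measurable_fun setT (EFin \o p) by exact/measurable_EFinP.
pose h := nnsfun_approx measurableT mf.
have fE x : f x = limn (fun n => (h n x)%:E).
  by apply/esym/cvg_lim => //; exact: cvg_nnsfun_approx.
transitivity (limn (fun n => \int[P]_x (h n x)%:E))%E.
  under eq_integral do rewrite fE.
  apply: monotone_convergence => //.
  - by move=> n; exact/measurable_EFinP/measurable_funP.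
  - by move=> n x _; rewrite lee_fin.
  - by move=> x _ a b ab; rewrite lee_fin; exact/lefP/nd_nnsfun_approx.
transitivity (limn (fun n => \int[mu]_x ((h n x)%:E * (p x)%:E)))%E; last first.
  apply/esym; under eq_integral.
    move=> x _; rewrite (_ : (f x * _ = limn (fun n => (h n x)%:E * (p x)%:E))%E).
      over.
    apply/esym/cvg_lim => //; apply: cvgeZr => //.
    exact: cvg_nnsfun_approx.
  apply: monotone_convergence => //.
  - move=> n; apply: emeasurable_funM => //.
    exact/measurable_EFinP/measurable_funP.
  - by move=> n x _; rewrite mule_ge0 ?lee_fin.
  - by move=> x _ a b ab; rewrite lee_wpmul2r ?lee_fin//; exact/lefP/nd_nnsfun_approx.
congr (limn _); apply/funext => n.
have mh (y : R) : measurable (h n @^-1` [set y]) by exact: measurable_sfunP.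
rewrite integralT_nnsfun sintegralE.
transitivity (\int[mu]_x (\sum_(y \in range (h n))
    (y * \1_(h n @^-1` [set y]) x)%:E * (p x)%:E))%E; last first.
  apply: eq_integral => x _; rewrite (fimfunE (h n) x) -fsumEFin//.
  by rewrite ge0_mule_fsuml// => y; rewrite EFinM nnfun_muleindic_ge0.
rewrite ge0_integral_fsum//; last 2 first.
- move=> y; apply: emeasurable_funM => //; apply/measurable_EFinP.
  by apply: measurable_funM => //; exact: measurable_indic.
- by move=> y x _; rewrite mule_ge0 ?lee_fin//; first by rewrite -lee_fin EFinM nnfun_muleindic_ge0.
apply: eq_fsbigr => y /set_mem [x _ <-].
have hx0 : 0 <= h n x by [].
under eq_integral do rewrite EFinM -muleA.
rewrite ge0_integralZl//; last 2 first.
- apply: emeasurable_funM => //; apply/measurable_EFinP.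
  exact: measurable_indic.
- by move=> z _; rewrite mule_ge0 ?lee_fin.
congr (_ * _)%E; rewrite PE// integral_mkcond; apply: eq_integral => z _.
by rewrite patchE indicE; case: (z \in _); rewrite ?mul1e ?mul0e.
Qed.

End density.

Section unit_functions.
Context d (T : measurableType d) (R : realType).
Implicit Types (g : T -> R) (P : probability T R).

Definition unit_fun g := measurable_fun setT g /\ forall x, 0 <= g x <= 1.

Lemma bounded_integrable P g (K : R) : measurable_fun setT g ->
  (forall x, 0 <= g x <= K) -> P.-integrable setT (EFin \o g).
Proof.
move=> mg gK; apply: measurable_bounded_integrable => //.
  by rewrite [ltLHS]probability_setT ltry.
exists K; split; first exact: num_real.
move=> M KM x _ /=; have /andP[g0 gk] := gK x.
by rewrite ger0_norm// (le_trans gk)// ltW.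
Qed.

Lemma Rintegral_cst_probability P (r : R) : \int[P]_x r = r.
Proof.
rewrite Rintegral_cst//; transitivity (r * 1); last by rewrite mulr1.
by congr (_ * _); exact: (congr1 fine (probability_setT P)).
Qed.

Lemma unit_integrable P g : unit_fun g -> P.-integrable setT (EFin \o g).
Proof. by move=> [mg g01]; exact: (bounded_integrable P mg g01). Qed.

Lemma EFin_Rintegral P g : unit_fun g ->
  (\int[P]_x g x)%:E = (\int[P]_x (g x)%:E)%E.
Proof.
by move=> ug; rewrite fineK//; apply: integrable_fin_num => //; exact: unit_integrable.
Qed.

Lemma Rintegral_unit P g : unit_fun g -> 0 <= \int[P]_x g x <= 1.
Proof.
move=> ug; have [mg g01] := ug; apply/andP; split.
  by apply: Rintegral_ge0 => x _; have /andP[] := g01 x.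
have := @le_Rintegral _ _ _ P setT g (cst 1) measurableT (unit_integrable P ug).
rewrite Rintegral_cst_probability; apply.
  by apply: (bounded_integrable P (K := 1)) => // x; rewrite /= ler01 lexx.
by move=> x _; have /andP[] := g01 x.
Qed.

Lemma Rintegral_affine P g (a b : R) : unit_fun g ->
  \int[P]_x (a * (g x + b)) = a * (\int[P]_x g x + b).
Proof.
move=> ug; have ig := unit_integrable P ug.
have ib : P.-integrable setT (EFin \o cst b) by exact: finite_measure_integrable_cst.
rewrite RintegralZl//; last by rewrite (_ : _ \o _ = (EFin \o g) \+ (EFin \o cst b))%E//; exact: integrableD.
by rewrite RintegralD// Rintegral_cst_probability.
Qed.

End unit_functions.

Section product_law.
Context d (T : measurableType d) (R : realType).
Implicit Types (P : probability T R).

(** Results on [n] records are proved by induction along this recursion; the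
    first record is integrated last. *)
Lemma ge0_integral_iid_cons P n (f : n.+1.-tuple T -> \bar R) :
  measurable_fun setT f -> (forall D, 0 <= f D)%E ->
  (\int[iid P n.+1]_D f D = \int[P]_z \int[iid P n]_D f (cons_pair (z, D)))%E.
Proof.
move=> mf f0.
rewrite /= ge0_integral_distribution//.
apply: (fubini_tonelli1 (fun x => f (cons_pair x))) => //.
by apply: measurableT_comp => //; exact: measurable_funP.
Qed.

Lemma measurable_cons_pair_r n (z : T) :
  measurable_fun setT (fun D : n.-tuple T => cons_pair (z, D)).
Proof.
by apply: (measurable_cons (f := cst z) (g := id)).
Qed.

Lemma unit_fun_cons n (g : n.+1.-tuple T -> R) (z : T) :
  unit_fun g -> unit_fun (fun D => g (cons_pair (z, D))).
Proof.
move=> [mg g01]; split=> //; apply: (measurableT_comp mg).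
exact: measurable_cons_pair_r.
Qed.

Lemma unit_fun_Rintegral_cons P n (g : n.+1.-tuple T -> R) :
  unit_fun g -> unit_fun (fun z => \int[iid P n]_D g (cons_pair (z, D))).
Proof.
move=> ug; split; last by move=> z; apply: Rintegral_unit; exact: unit_fun_cons.
apply: (@measurableT_comp _ _ _ _ _ _ (@fine R)) => //.
apply: (measurable_fun_fubini_tonelli_F (fun x => (g (cons_pair x))%:E)).
  have [mg _] := ug.
  by apply/measurable_EFinP; apply: (measurableT_comp mg); exact: measurable_funP.
by move=> x; rewrite lee_fin; have [_ /(_ (cons_pair x))/andP[]] := ug.
Qed.

Lemma Rintegral_iid_cons P n (g : n.+1.-tuple T -> R) : unit_fun g ->
  \int[iid P n.+1]_D g D = \int[P]_z \int[iid P n]_D g (cons_pair (z, D)).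
Proof.
move=> ug; have [mg g01] := ug; congr fine; rewrite ge0_integral_iid_cons.
- by apply: eq_integral => z _; rewrite EFin_Rintegral//; exact: unit_fun_cons.
- exact/measurable_EFinP.
- by move=> D; rewrite lee_fin; have /andP[] := g01 D.
Qed.

Lemma Rintegral_iid0 P (g : 0.-tuple T -> R) : unit_fun g ->
  \int[iid P 0]_D g D = g [tuple].
Proof.
move=> [mg _]; rewrite /Rintegral/= integral_dirac//; last exact/measurable_EFinP.
by rewrite diracT mul1e.
Qed.

End product_law.

(** * Private algorithms under a change of law *)

Section tensorization.
Context d (T : measurableType d) (R : realType).
Implicit Types (P Q : probability T R) (q : T -> R).

(** Total variation at most [t], in dual form: this is what survives integration
    of the other records. *)
Definition tv_le P Q (t : R) : Prop :=
  forall (k : T -> R) (K : R), measurable_fun setT k -> 0 <= K ->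
    (forall x, 0 <= k x <= K) -> \int[P]_x k x <= \int[Q]_x k x + K * t.

(** After subtracting its infimum [c], a function [k] with
    [k z <= e * k z' + r] is at most [(e - 1) * c + r], so changing the law in
    total variation by [t] changes its mean by at most [t] times that. *)
Lemma tv_private_step P Q (t e r : R) (k : T -> R) :
  tv_le P Q t -> 0 <= t -> 1 <= e -> 0 <= r -> unit_fun k ->
  (forall z z', k z <= e * k z' + r) ->
  \int[P]_x k x <= (1 + (e - 1) * t) * \int[Q]_x k x + t * r.
Proof.
move=> tvPQ t0 e1 r0 uk kk; have [mk k01] := uk.
have e0 : 0 < e by exact: lt_le_trans e1.
have [z0 _] : exists z : T, True.
  apply: contrapT => noz; have := probability_setT P.
  rewrite (_ : setT = set0) ?measure0.
    by move=> /eqP; rewrite eqe eq_sym oner_eq0.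
  by apply/seteqP; split=> z // _; apply: noz; exists z.
pose c := inf (range k).
have ne : range k !=set0 by exists (k z0), z0.
have c_le z : c <= k z.
  apply: ge_inf; last by exists z.
  by exists 0 => _ [y _ <-]; have /andP[] := k01 y.
have k_le z : k z <= e * c + r.
  rewrite -lerBlDr -ler_pdivrMl//; apply: lb_le_inf => // _ [y _ <-].
  by rewrite ler_pdivrMl// lerBlDr.
have c0 : 0 <= c by apply: lb_le_inf => // _ [y _ <-]; have /andP[] := k01 y.
have icst (L : probability T R) (a : R) : L.-integrable setT (EFin \o cst a).
  exact: finite_measure_integrable_cst.
have intB (L : probability T R) : \int[L]_x (k x - c) = \int[L]_x k x - c.
  rewrite RintegralB//; first by rewrite Rintegral_cst_probability.
    exact: unit_integrable.
  exact: icst.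
have Hc (L : probability T R) : c <= \int[L]_x k x.
  rewrite -[leLHS](Rintegral_cst_probability L); apply: le_Rintegral => //.
    exact: icst.
  exact: unit_integrable.
have := tvPQ (fun x => k x - c) ((e - 1) * c + r).
rewrite !intB => /(_ _ _ _)/wrap[].
- exact: measurable_funB.
- by rewrite addr_ge0// mulr_ge0// subr_ge0.
- move=> x; rewrite subr_ge0 c_le/=; have := k_le x; lra.
move=> H; have HQ := Hc Q.
have : (e - 1) * t * c <= (e - 1) * t * \int[Q]_x k x.
  by rewrite ler_wpM2l// mulr_ge0// subr_ge0.
lra.
Qed.

(** Group privacy in product form: each coordinate whose law changes by [t] in
    total variation costs a factor [1 + (e - 1) * t] instead of [e]. *)
Lemma tv_private_iid P Q (t e r : R) n (g : n.-tuple T -> R) :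
  tv_le P Q t -> 0 <= t -> 1 <= e -> 0 <= r -> unit_fun g ->
  (forall (i : 'I_n) (D D' : n.-tuple T),
     (forall j, j != i -> tnth D j = tnth D' j) -> g D <= e * g D' + r) ->
  \int[iid P n]_D g D
    <= (1 + (e - 1) * t) ^+ n * (\int[iid Q n]_D g D + n%:R * t * r).
Proof.
move=> tvPQ t0 e1 r0; set a := 1 + _.
have a1 : 1 <= a by rewrite lerDl mulr_ge0// subr_ge0.
have a0 : 0 <= a by exact: le_trans a1.
elim: n g => [|n IH] g ug gg.
  by rewrite !Rintegral_iid0// expr0 mul1r !mul0r addr0.
have ugc z := unit_fun_cons z ug.
rewrite !Rintegral_iid_cons//.
pose k z := \int[iid Q n]_D g (cons_pair (z, D)).
have uk : unit_fun k by exact: unit_fun_Rintegral_cons.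
pose b := n%:R * t * r.
have b0 : 0 <= b by rewrite !mulr_ge0.
have e0 : 0 < e by exact: lt_le_trans e1.
have inner z : \int[iid P n]_D g (cons_pair (z, D)) <= a ^+ n * (k z + b).
  apply: IH => // i D D' DD'; apply: (gg (lift ord0 i)) => j.
  case: (unliftP ord0 j) => [j' ->|-> _]; last by rewrite /cons_pair/= !tnth0.
  rewrite (inj_eq lift_inj) => j'i; rewrite /cons_pair/= !tnthS; exact: DD'.
have step1 : \int[P]_z \int[iid P n]_D g (cons_pair (z, D))
    <= a ^+ n * (\int[P]_z k z + b).
  rewrite -Rintegral_affine//; apply: le_Rintegral => //.
  - exact/unit_integrable/unit_fun_Rintegral_cons.
  - apply: (bounded_integrable P (K := a ^+ n * (1 + b))).
      by apply: measurable_funM => //; apply: measurable_funD => //; have [] := uk.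
    move=> z; have [_ /(_ z)/andP[k0 k1]] := uk.
    apply/andP; split; first by apply: mulr_ge0; [exact: exprn_ge0|exact: addr_ge0].
    by apply: ler_wpM2l; [exact: exprn_ge0|rewrite lerD2r].
have step2 : \int[P]_z k z <= a * \int[Q]_z k z + t * r.
  apply: tv_private_step => // z z'.
  have -> : e * k z' + r = e * (k z' + r / e) by rewrite mulrDr mulrCA divff ?mulr1 ?gt_eqF.
  rewrite -Rintegral_affine//; apply: le_Rintegral => //.
  - exact: unit_integrable.
  - apply: (bounded_integrable _ (K := e * (1 + r / e))).
      by apply: measurable_funM => //; apply: measurable_funD => //; have [] := ugc z'.
    move=> D; have [_ /(_ D)/andP[k0 k1]] := ugc z'.
    apply/andP; split; first by apply: mulr_ge0; [exact: ltW|apply: addr_ge0 => //; apply: divr_ge0 => //; exact: ltW].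
    by apply: ler_wpM2l; [exact: ltW|rewrite lerD2r].
  - move=> D _; rewrite mulrDr [e * (r / e)]mulrCA divff ?mulr1 ?gt_eqF//.
    apply: (gg ord0) => j; case: (unliftP ord0 j) => [j' ->|-> /eqP//] _.
    by rewrite /cons_pair/= !tnthS.
apply: (le_trans step1); rewrite exprSr -mulrA ler_wpM2l ?exprn_ge0//.
rewrite -/(k _) mulrDr; apply: (@le_trans _ _ (a * \int[Q]_z k z + (t * r + b))).
  by rewrite addrA lerD2r.
rewrite lerD2l (_ : n.+1%:R * t * r = t * r + b); last by rewrite /b -natr1; ring.
by rewrite ler_peMl// addr_ge0// mulr_ge0.
Qed.
End tensorization.

(** * Truncated chi-square comparison of product laws *)

Section truncated_chi_square.
Context d (T : measurableType d) (R : realType).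
Implicit Types (P Q : probability T R) (q : T -> R).

(** In dual form: [expR (- q)] times the density of [P] has norm at most [1] in
    [L^2 (Q)]. *)
Definition weighted_l2_le P Q q : Prop :=
  forall k : T -> R, unit_fun k ->
    \int[P]_x (expR (- q x) * k x) <= Num.sqrt (\int[Q]_x k x ^+ 2).

Definition tuple_sum q n (D : n.-tuple T) : R := \sum_(i < n) q (tnth D i).

Lemma tuple_sum_cons q n z (D : n.-tuple T) :
  tuple_sum q (cons_pair (z, D)) = q z + tuple_sum q D.
Proof.
rewrite /tuple_sum big_ord_recl /cons_pair/= tnth0; congr (_ + _).
by apply: eq_bigr => i _; rewrite tnthS.
Qed.

Lemma measurable_tuple_sum q n : measurable_fun setT q ->
  measurable_fun setT (@tuple_sum q n).
Proof.
move=> mq; apply: measurable_sum => i.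
by apply: (measurableT_comp mq); exact: measurable_tnth.
Qed.

Lemma tuple_sum_ge0 q n (D : n.-tuple T) : (forall x, 0 <= q x) -> 0 <= tuple_sum q D.
Proof. by move=> q0; apply: sumr_ge0. Qed.

Lemma unit_fun_weight d' (U : measurableType d') (f g : U -> R) :
  measurable_fun setT f -> (forall x, 0 <= f x) -> unit_fun g ->
  unit_fun (fun x => expR (- f x) * g x).
Proof.
move=> mf f0 [mg g01]; split.
  apply: measurable_funM => //; apply: (measurableT_comp (@measurable_expR R)).
  exact: measurable_funN.
move=> x; have /andP[g0 g1] := g01 x.
by rewrite mulr_ge0 ?expR_ge0//= mulr_ile1 ?expR_ge0// expR_le1 oppr_le0.
Qed.

Lemma unit_fun_sqr d' (U : measurableType d') (g : U -> R) :
  unit_fun g -> unit_fun (fun x => g x ^+ 2).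
Proof.
move=> [mg g01]; split; first exact: measurable_funX.
by move=> x; have /andP[g0 g1] := g01 x; rewrite sqr_ge0 expr_le1.
Qed.

(** The weights multiply over the coordinates, and so do the second moments of
    the likelihood ratio that they tame. *)
Lemma weighted_l2_iid P Q q n (g : n.-tuple T -> R) :
  measurable_fun setT q -> (forall x, 0 <= q x) ->
  weighted_l2_le P Q q -> unit_fun g ->
  \int[iid P n]_D (expR (- tuple_sum q D) * g D)
    <= Num.sqrt (\int[iid Q n]_D g D ^+ 2).
Proof.
move=> mq q0 PQ; elim: n g => [|n IH] g ug.
  rewrite !Rintegral_iid0; last 2 first.
  - exact: unit_fun_sqr.
  - apply: unit_fun_weight => //; first exact: measurable_tuple_sum.
    by move=> D; exact: tuple_sum_ge0.
  have [_ /(_ [tuple])/andP[g0 _]] := ug.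
  by rewrite sqrtr_sqr ger0_norm// /tuple_sum big_ord0 oppr0 expR0 mul1r.
have ugc z := unit_fun_cons z ug.
have mS : measurable_fun setT (@tuple_sum q n) by exact: measurable_tuple_sum.
have S0 (D : n.-tuple T) : 0 <= tuple_sum q D by exact: tuple_sum_ge0.
rewrite !Rintegral_iid_cons; last 2 first.
- exact: unit_fun_sqr.
- apply: unit_fun_weight => //; first exact: measurable_tuple_sum.
  by move=> D; exact: tuple_sum_ge0.
pose I z := \int[iid Q n]_D g (cons_pair (z, D)) ^+ 2.
have uI : unit_fun I.
  apply: (unit_fun_Rintegral_cons Q (g := fun D => g D ^+ 2)).
  exact: unit_fun_sqr.
pose k z := Num.sqrt (I z).
have uk : unit_fun k.
  have [mI I01] := uI; split.
    apply: (measurableT_comp _ mI); apply: continuous_measurable_fun.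
    exact: sqrt_continuous.
  move=> z; have /andP[I0 I1] := I01 z.
  by rewrite sqrtr_ge0 -[leRHS]sqrtr1 ler_wsqrtr.
have kI : \int[Q]_z I z = \int[Q]_z k z ^+ 2.
  apply: eq_Rintegral => z _; rewrite sqr_sqrtr//.
  by have [_ /(_ z)/andP[]] := uI.
rewrite -/I kI; apply: le_trans (PQ k uk).
have inner z : \int[iid P n]_D (expR (- tuple_sum q (cons_pair (z, D))) * g (cons_pair (z, D)))
    <= expR (- q z) * k z.
  under eq_Rintegral do rewrite tuple_sum_cons opprD expRD -mulrA.
  rewrite RintegralZl//; last exact/unit_integrable/unit_fun_weight.
  by rewrite ler_wpM2l ?expR_ge0//; exact: IH.
apply: le_Rintegral => //.
- apply: unit_integrable.
  apply: (unit_fun_Rintegral_cons P (g := fun D => expR (- tuple_sum q D) * g D)).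
  apply: unit_fun_weight => //; first exact: measurable_tuple_sum.
  by move=> D; exact: tuple_sum_ge0.
- exact/unit_integrable/unit_fun_weight.
Qed.

Lemma integral_tuple_sum P q n : measurable_fun setT q -> (forall x, 0 <= q x) ->
  (\int[iid P n]_D (tuple_sum q D)%:E = n%:R%:E * \int[P]_x (q x)%:E)%E.
Proof.
move=> mq q0; have mqE : measurable_fun setT (EFin \o q) by exact/measurable_EFinP.
elim: n => [|n IH].
  rewrite mul0e /tuple_sum; under eq_integral do rewrite big_ord0.
  exact: integral0.
rewrite ge0_integral_iid_cons; last 2 first.
- by apply/measurable_EFinP; exact: measurable_tuple_sum.
- by move=> D; rewrite lee_fin tuple_sum_ge0.
have mS : measurable_fun setT (EFin \o @tuple_sum q n).
  by apply/measurable_EFinP; exact: measurable_tuple_sum.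
transitivity (\int[P]_x ((q x)%:E + n%:R%:E * \int[P]_x (q x)%:E))%E.
  apply: eq_integral => z _; under eq_integral do rewrite tuple_sum_cons EFinD.
  rewrite ge0_integralD//; last 2 first.
  - by move=> x _; rewrite lee_fin.
  - by move=> x _; rewrite lee_fin tuple_sum_ge0.
  by rewrite integral_cst// [X in (_ * X)%E](probability_setT (iid P n)) mule1 -IH.
have I0 : (0 <= \int[P]_x (q x)%:E)%E by apply: integral_ge0 => x _; rewrite lee_fin.
rewrite ge0_integralD//; last 2 first.
- by move=> x _; rewrite lee_fin.
- by move=> x _; rewrite mule_ge0.
rewrite integral_cst// [X in (_ * X)%E](probability_setT P) mule1.
by rewrite -natr1 EFinD ge0_muleDl// ?lee_fin// mul1e addeC.
Qed.

(** On the event that the accumulated weight exceeds [a] (of probability at most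
    [n * m / a]) the weight is useless; elsewhere it costs a factor [expR a]. *)
Lemma weighted_l2_change_of_law P Q q n (g : n.-tuple T -> R) (a m : R) :
  measurable_fun setT q -> (forall x, 0 <= q x) ->
  weighted_l2_le P Q q -> unit_fun g -> 0 < a ->
  (\int[P]_x (q x)%:E <= m%:E)%E ->
  \int[iid P n]_D g D
    <= expR a * Num.sqrt (\int[iid Q n]_D g D) + n%:R * m / a.
Proof.
move=> mq q0 PQ ug a0 qm; have [mg g01] := ug.
have S0 (D : n.-tuple T) : 0 <= tuple_sum q D by exact: tuple_sum_ge0.
have mS : measurable_fun setT (@tuple_sum q n) by exact: measurable_tuple_sum.
pose w (D : n.-tuple T) := expR (- tuple_sum q D) * g D.
have uw : unit_fun w by exact: unit_fun_weight.
have [mw w01] := uw.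
have mwE : measurable_fun setT (EFin \o w) by exact/measurable_EFinP.
have mSE : measurable_fun setT (EFin \o @tuple_sum q n) by exact/measurable_EFinP.
have w0E D : [set: n.-tuple T] D -> (0 <= (w D)%:E)%E.
  by rewrite lee_fin; have /andP[] := w01 D.
have S0E (D : n.-tuple T) : [set: n.-tuple T] D -> (0 <= (tuple_sum q D)%:E)%E.
  by rewrite lee_fin.
have mc (c : R) (f : n.-tuple T -> R) : measurable_fun setT (EFin \o f) ->
    measurable_fun setT (fun D => c%:E * (f D)%:E)%E.
  by move=> mf; exact: measurable_funeM.
have pointwise D : g D <= expR a * w D + a^-1 * tuple_sum q D.
  have /andP[g0 g1] := g01 D; have /andP[w0 _] := w01 D.
  have [Sa|/ltW Sa] := leP (tuple_sum q D) a.
    rewrite -[leLHS]addr0 lerD//; last by rewrite mulr_ge0// invr_ge0 ltW.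
    rewrite mulrA -expRD -[leLHS]mul1r ler_wpM2r// -expR0 ler_expR.
    by rewrite subr_ge0.
  rewrite -[leLHS]add0r lerD ?mulr_ge0 ?expR_ge0// (le_trans g1)//.
  by rewrite mulrC ler_pdivlMr// mul1r.
have : \int[iid P n]_D g D <= expR a * \int[iid P n]_D w D + n%:R * m / a.
  rewrite -lee_fin EFin_Rintegral//.
  apply: (@le_trans _ _ (\int[iid P n]_D ((expR a)%:E * (w D)%:E + (a^-1)%:E * (tuple_sum q D)%:E))%E).
    apply: ge0_le_integral => //.
    - by move=> D _; rewrite lee_fin; have /andP[] := g01 D.
    - exact/measurable_EFinP.
    - by apply: emeasurable_funD; exact: mc.
    - by move=> D _; rewrite -!EFinM -EFinD lee_fin.
  rewrite ge0_integralD//; last 4 first.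
  - by move=> D _; rewrite mule_ge0 ?lee_fin ?expR_ge0//; have /andP[] := w01 D.
  - exact: mc.
  - by move=> D _; rewrite -EFinM lee_fin mulr_ge0// invr_ge0 ltW.
  - exact: mc.
  rewrite !ge0_integralZl_EFin ?expR_ge0 ?invr_ge0 ?(ltW a0)//.
  rewrite integral_tuple_sum// EFinD EFinM EFin_Rintegral// leeD2l//.
  rewrite [n%:R * m / a]mulrC EFinM lee_wpmul2l//; first by rewrite lee_fin invr_ge0 ltW.
  by rewrite EFinM lee_wpmul2l.
move=> H; apply: (le_trans H); rewrite lerD2r ler_wpM2l ?expR_ge0//.
apply: (le_trans (weighted_l2_iid mq q0 PQ ug)); rewrite ler_wsqrtr//.
apply: le_Rintegral => //; [exact/unit_integrable/unit_fun_sqr|exact: unit_integrable|].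
by move=> D _; have /andP[g0 g1] := g01 D; rewrite expr2 ler_piMl.
Qed.

End truncated_chi_square.

(** * Comparison of two parameters of the model *)

Lemma le_sqrt_of_AMGM (R : realType) (x y : R) : 0 <= y ->
  (forall l, 0 < l -> x <= (y / l + l) / 2) -> x <= Num.sqrt y.
Proof.
rewrite le_eqVlt => /predU1P[<- H|y0 H].
  rewrite sqrtr0 leNgt; apply/negP => x0.
  have := H x x0; rewrite mul0r add0r; lra.
have s0 : 0 < Num.sqrt y by rewrite sqrtr_gt0.
have := H _ s0; rewrite -{1}(sqr_sqrtr (ltW y0)) expr2 mulfK ?gt_eqF//; lra.
Qed.

(** With [u ^ 2] and [v ^ 2] for two densities at a point, [u * v] is the
    integrand of their Hellinger affinity; [l] comes from the weighted
    arithmetic-geometric mean inequality for [|u - v| * (u + v)]. *)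
Lemma hellinger_pointwise (R : realType) (k K l u v : R) :
  0 <= k -> k <= K -> 0 < l -> 0 <= u -> 0 <= v ->
  k * u ^+ 2 + K * l * (u * v) <=
    k * v ^+ 2 + K * (l / 2 + l^-1) * (u ^+ 2 + v ^+ 2).
Proof.
move=> k0 kK l0 u0 v0; have K0 : 0 <= K by exact: le_trans kK.
have core (x y : R) : (x - y) * (x + y) + l * (x * y) <= (l / 2 + l^-1) * (x ^+ 2 + y ^+ 2).
  rewrite -subr_ge0.
  rewrite (_ : _ - _ = ((l * (x - y) - (x + y)) ^+ 2 + (x - y) ^+ 2) / (2 * l)); last first.
    by field; rewrite gt_eqF.
  by rewrite divr_ge0 ?addr_ge0 ?sqr_ge0// mulr_ge0// ltW.
have diff (x y : R) : 0 <= x -> 0 <= y -> y <= x -> 0 <= (x - y) * (x + y).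
  by move=> x0 y0 xy; rewrite mulr_ge0 ?subr_ge0// addr_ge0.
have [uv|/ltW vu] := leP u v.
  have h1 := diff _ _ v0 u0 uv.
  have := core v u => /(ler_wpM2l K0).
  have := mulr_ge0 k0 h1; have := mulr_ge0 K0 h1; lra.
have h1 := diff _ _ u0 v0 vu.
have := core u v => /(ler_wpM2l K0).
have : 0 <= (K - k) * ((u - v) * (u + v)) by rewrite mulr_ge0// subr_ge0.
lra.
Qed.

(** The combination that ends [glm_tv_le], with the affinity [A] not yet known to
    be finite. *)
Lemma le_of_affinity (R : realType) (x y s r e : R) (A : \bar R) :
  0 <= r -> (0 <= A)%E -> (1 <= A + e%:E)%E ->
  (x%:E + r%:E * A <= y%:E + (s%:E + s%:E))%E ->
  x <= y + (s + s + r * e - r).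
Proof.
move=> r0; case: A => [A A0 Ae|_ _|//].
  rewrite -EFinM -!EFinD lee_fin => H; rewrite -EFinD lee_fin in Ae.
  have := ler_wpM2l r0 Ae; lra.
move: r0; rewrite le_eqVlt => /predU1P[<-|r_gt0].
  by rewrite mul0e adde0 -!EFinD lee_fin; lra.
by rewrite gt0_muley ?lte_fin// -!EFinD addey// leye_eq.
Qed.

Section glm_tilt.
Context {R : realType} {d : nat} (m : glm R d).
Local Notation c := (glm_scale m).
Local Notation psi := (glm_psi m).
Local Notation nu := (glm_mu m \x glm_fx m)%E.
Implicit Types (b : d.-tuple R) (t K : d.-tuple R -> R).

(** The geometric means of two densities of the model, including the extrapolated
    [p ^ 2 / p'] of the chi-square divergence, have this form, also when weighted
    by an exponential function of the covariate. *)
Definition tilt t K (z : record R d) : R :=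
  glm_h m z.1 (glm_sigma m) * expR ((z.1 * t z.2 + K z.2) / c).

Lemma scale_gt0 : 0 < c. Proof. exact: glm_c_gt0. Qed.

Lemma tilt_ge0 t K z : 0 <= tilt t K z.
Proof. by rewrite mulr_ge0 ?glm_h_ge0 ?expR_ge0. Qed.

Lemma measurable_tilt t K : measurable_fun setT t -> measurable_fun setT K ->
  measurable_fun setT (tilt t K).
Proof.
move=> mt mK; apply: measurable_funM.
  exact: (measurableT_comp (glm_h_measurable m) measurable_fst).
apply: (measurableT_comp (@measurable_expR R)).
apply: measurable_funM => //; apply: measurable_funD.
  by apply: measurable_funM => //; exact: (measurableT_comp mt measurable_snd).
exact: (measurableT_comp mK measurable_snd).
Qed.

(** Integrating out the response, whose law is an exponential family with
    log-partition function [psi / c]. *)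
Lemma integral_tilt (f : d.-tuple R -> R) t K :
  measurable_fun setT f -> measurable_fun setT t -> measurable_fun setT K ->
  (forall x, 0 <= f x) ->
  (\int[nu]_z (f z.2 * tilt t K z)%:E =
   \int[glm_fx m]_x (f x * expR ((psi (t x) + K x) / c))%:E)%E.
Proof.
move=> mf mt mK f0.
rewrite fubini_tonelli2; last 2 first.
- apply/measurable_EFinP/measurable_funM; last exact: measurable_tilt.
  exact: (measurableT_comp mf measurable_snd).
- by move=> z; rewrite lee_fin mulr_ge0// tilt_ge0.
apply: eq_integral => x _; rewrite /fubini_G.
transitivity (\int[glm_mu m]_y ((f x * expR ((psi (t x) + K x) / c))%:E *
   (glm_h m y (glm_sigma m) * expR ((y * t x - psi (t x)) / glm_c m (glm_sigma m)))%:E))%E.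
  apply: eq_integral => y _; rewrite -EFinM /tilt/=; congr EFin.
  rewrite -/c -mulrA; congr (_ * _); rewrite mulrCA -expRD; congr (_ * expR _).
  by rewrite -mulrDl; congr (_ / _); ring.
rewrite ge0_integralZl_EFin//.
- by rewrite glm_density_mass1 mule1.
- by move=> y _; rewrite lee_fin mulr_ge0 ?glm_h_ge0 ?expR_ge0.
- apply/measurable_EFinP/measurable_funM; first exact: glm_h_measurable.
  apply: (measurableT_comp (@measurable_expR R)).
  by apply: measurable_funM => //; apply: measurable_funB => //; exact: measurable_funM.
- by rewrite mulr_ge0 ?expR_ge0.
Qed.

Lemma integral_glm_law b (f : record R d -> \bar R) :
  (forall z, 0 <= f z)%E -> measurable_fun setT f ->
  (\int[glm_law m b]_z f z = \int[nu]_z (f z * (glm_density m b z)%:E))%E.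
Proof.
move=> f0 mf; apply: (ge0_integral_density (mu := nu) (P := glm_law m b)) => //.
- exact: glm_density_ge0.
- exact: measurable_glm_density.
Qed.

Lemma measurable_psi_dotv b : measurable_fun setT (fun x => - psi (dotv x b)).
Proof.
apply: measurable_funN; apply: (measurableT_comp (measurable_glm_psi m)).
exact: measurable_dotv.
Qed.

Lemma EFin_Rintegral_glm_law b (k : record R d -> R) (K : R) :
  measurable_fun setT k -> (forall z, 0 <= k z <= K) ->
  ((\int[glm_law m b]_z k z)%:E = \int[nu]_z (k z * glm_density m b z)%:E)%E.
Proof.
move=> mk kK; rewrite fineK; last first.
  by apply: integrable_fin_num => //; exact: (bounded_integrable _ mk kK).
rewrite integral_glm_law//.
- by move=> z; rewrite lee_fin; have /andP[] := kK z.
- exact/measurable_EFinP.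
Qed.

Definition zero_vec : d.-tuple R := [tuple 0 | _ < d].

Lemma dotv0 (x : d.-tuple R) : dotv x zero_vec = 0.
Proof. by rewrite /dotv big1// => i _; rewrite tnth_mktuple mulr0. Qed.

Variables (c2 : R) (b : d.-tuple R) (M : R).
Hypothesis c2_ge0 : 0 <= c2.
Hypothesis psi_c2 : forall u, psi (2 * u) - 2 * psi u + psi 0 <= c2 * u ^+ 2.
Hypothesis moment2 : (\int[glm_fx m]_x ((dotv x b) ^+ 2)%:E <= M%:E)%E.

Let th (x : d.-tuple R) := dotv x b.
Let mth : measurable_fun setT th. Proof. exact: measurable_dotv. Qed.
Let mth2 : measurable_fun setT (fun x => th x ^+ 2).
Proof. exact: measurable_funX. Qed.
Let mpsi : measurable_fun setT (fun x => psi (th x)).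
Proof. exact: (measurableT_comp (measurable_glm_psi m)). Qed.

Definition glm_weight (z : record R d) : R := c2 / (2 * c) * dotv z.2 b ^+ 2.

Let w0 x : 0 <= c2 / (2 * c) * th x ^+ 2.
Proof. by rewrite mulr_ge0 ?sqr_ge0// divr_ge0// mulr_ge0// ltW// scale_gt0. Qed.

Lemma glm_weight_ge0 z : 0 <= glm_weight z. Proof. exact: w0. Qed.

Lemma measurable_glm_weight : measurable_fun setT glm_weight.
Proof.
apply: measurable_funM => //; apply: (measurableT_comp mth2 measurable_snd).
Qed.

Lemma integral_glm_weight_le :
  (\int[glm_law m b]_z (glm_weight z)%:E <= (c2 / (2 * c) * M)%:E)%E.
Proof.
rewrite integral_glm_law; last 2 first.
- by move=> z; rewrite lee_fin glm_weight_ge0.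
- by apply/measurable_EFinP; exact: measurable_glm_weight.
under eq_integral do rewrite -EFinM.
rewrite (integral_tilt (f := fun x => c2 / (2 * c) * th x ^+ 2) (t := th)
  (K := fun x => - psi (th x)))//; last 2 first.
- exact: measurable_funM.
- exact: measurable_psi_dotv.
under eq_integral do rewrite subrr mul0r expR0 mulr1 EFinM.
rewrite ge0_integralZl_EFin//; last 3 first.
- by move=> x _; rewrite lee_fin sqr_ge0.
- exact/measurable_EFinP.
- by rewrite divr_ge0// mulr_ge0// ltW// scale_gt0.
by rewrite [leRHS]EFinM lee_wpmul2l// lee_fin divr_ge0// mulr_ge0// ltW// scale_gt0.
Qed.

(** The conditional second moment of the likelihood ratio given the covariate is
    [expR ((psi (2 th) - 2 psi th + psi 0) / c) <= expR (c2 th ^ 2 / c)], which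
    may fail to be integrable; the weight is chosen to cancel it. *)
Lemma glm_weighted_l2 :
  weighted_l2_le (glm_law m b) (glm_law m zero_vec) glm_weight.
Proof.
move=> k uk; have [mk k01] := uk.
have uk2 := unit_fun_sqr uk; have [mk2 k201] := uk2.
have uw := unit_fun_weight measurable_glm_weight glm_weight_ge0 uk.
have [mw w01] := uw.
apply: le_sqrt_of_AMGM => [|l l0].
  by have /andP[] := Rintegral_unit (glm_law m zero_vec) uk2.
pose K2 x := psi 0 - 2 * psi (th x) - c2 * th x ^+ 2.
have mK2 : measurable_fun setT K2.
  apply: measurable_funB; last exact: measurable_funM.
  by apply: measurable_funB => //; exact: measurable_funM.
pose r := tilt (fun x => 2 * th x) K2.
have mr : measurable_fun setT r by apply: measurable_tilt => //; exact: measurable_funM.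
have r1 : (\int[nu]_z (r z)%:E <= 1)%E.
  have -> : (\int[nu]_z (r z)%:E = \int[nu]_z ((cst 1 z.2 : R) * r z)%:E)%E.
    by apply: eq_integral => z _; rewrite mul1r.
  rewrite integral_tilt//; last exact: measurable_funM.
  apply: (@le_trans _ _ (\int[glm_fx m]_x 1)%E); last first.
    by rewrite integral_cst// mul1e [leLHS]probability_setT.
  apply: ge0_le_integral => //.
  - by move=> x _; rewrite lee_fin mul1r expR_ge0.
  - apply/measurable_EFinP; apply: measurable_funM => //.
    apply: (measurableT_comp (@measurable_expR R)); apply: measurable_funM => //.
    apply: measurable_funD => //.
    by apply: (measurableT_comp (measurable_glm_psi m)); exact: measurable_funM.
  - move=> x _; rewrite lee_fin /= mul1r expR_le1 pmulr_lle0 ?invr_gt0 ?scale_gt0//.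
    by rewrite /K2; have := psi_c2 (th x); lra.
rewrite -lee_fin (EFin_Rintegral_glm_law _ mw w01).
have p0 b' z : 0 <= glm_density m b' z by exact: glm_density_ge0.
have mp b' : measurable_fun setT (glm_density m b') by exact: measurable_glm_density.
apply: (@le_trans _ _ (\int[nu]_z (((2 * l)^-1)%:E * (k z ^+ 2 * glm_density m zero_vec z)%:E
   + (l / 2)%:E * (r z)%:E))%E).
  apply: ge0_le_integral => //.
  - by move=> z _; rewrite lee_fin mulr_ge0//; have /andP[] := w01 z.
  - by apply/measurable_EFinP; exact: measurable_funM.
  - apply: emeasurable_funD; apply: measurable_funeM; apply/measurable_EFinP => //.
    exact: measurable_funM.
  - move=> z _; rewrite -!EFinM -EFinD lee_fin.
    rewrite /r /tilt /glm_density dotv0 mulr0 sub0r -/(th z.2) /K2 /glm_weight -/(th z.2).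
    set h := glm_h m _ _; set y := z.1; set p := psi (th z.2); set p' := psi 0.
    set s := th z.2.
    (* The weighted likelihood ratio is split symmetrically around the null
       density h * expR (- p' / c). *)
    pose X := expR (- p' / (2 * c)) * k z.
    pose Y := expR (- (c2 / (2 * c) * s ^+ 2) + (y * s - p) / c + p' / (2 * c)).
    have c0 : c != 0 by rewrite gt_eqF// scale_gt0.
    rewrite [leLHS](_ : _ = h * (X * Y)); last first.
      rewrite /X /Y !expRD [- p' / _]mulNr (expRN (p' / _)).
      by field; rewrite gt_eqF// expR_gt0.
    rewrite [leRHS](_ : _ = h * ((2 * l)^-1 * X ^+ 2 + l / 2 * Y ^+ 2)); last first.
      rewrite /X /Y exprMn -!expRM_natl.
      rewrite (_ : 2%:R * (- p' / (2 * c)) = - p' / c); last by field.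
      rewrite (_ : 2%:R * (_ + _ + _) = (y * (2 * s) + (p' - 2 * p - c2 * s ^+ 2)) / c); last by field.
      by ring.
    apply: ler_wpM2l; first exact: glm_h_ge0.
    have -> : (2 * l)^-1 * X ^+ 2 + l / 2 * Y ^+ 2 = X * Y + (X - l * Y) ^+ 2 / (2 * l).
      by field; rewrite gt_eqF.
    by rewrite lerDl divr_ge0 ?sqr_ge0// mulr_ge0// ltW.
have l2 : 0 <= (2 * l)^-1 by rewrite invr_ge0 mulr_ge0// ltW.
have l2' : 0 <= l / 2 by rewrite divr_ge0// ltW.
have mkp : measurable_fun setT (fun z => (k z ^+ 2 * glm_density m zero_vec z)%:E).
  by apply/measurable_EFinP; exact: measurable_funM.
have kp0 z : (0 <= (k z ^+ 2 * glm_density m zero_vec z)%:E)%E.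
  by rewrite lee_fin mulr_ge0// sqr_ge0.
have mrE : measurable_fun setT (EFin \o r) by exact/measurable_EFinP.
have r0 z : (0 <= (r z)%:E)%E by rewrite lee_fin tilt_ge0.
rewrite ge0_integralD//; last 4 first.
- by move=> z _; rewrite mule_ge0.
- exact: measurable_funeM.
- by move=> z _; rewrite mule_ge0.
- exact: measurable_funeM.
rewrite !ge0_integralZl_EFin// -(EFin_Rintegral_glm_law _ mk2 k201).
rewrite (_ : (_ / l + l) / 2 = (2 * l)^-1 * \int[glm_law m zero_vec]_x k x ^+ 2 + l / 2 * 1); last first.
  by field; rewrite gt_eqF.
by rewrite EFinD !EFinM leeD2l// lee_wpmul2l.
Qed.

(** The Hellinger affinity of the two laws given the covariate is
    [expR ((psi (th / 2) - psi th / 2 - psi 0 / 2) / c)], at least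
    [1 - c2 th ^ 2 / (8 c)]; [l] is left to be balanced against the second
    moment of [th]. *)
Lemma glm_tv_le (l : R) : 0 < l ->
  tv_le (glm_law m b) (glm_law m zero_vec) (l * (c2 / (8 * c) * M) + 2 / l).
Proof.
move=> l0 k K mk K0 kK.
have cp : 0 < c := scale_gt0.
have c0 : c != 0 by rewrite gt_eqF.
pose Ka x := - (psi (th x) + psi 0) / 2.
have mKa : measurable_fun setT Ka.
  by apply: measurable_funM => //; apply: measurable_funN; exact: measurable_funD.
have mt2 : measurable_fun setT (fun x => th x / 2) by exact: measurable_funM.
pose aff := tilt (fun x => th x / 2) Ka.
have maff : measurable_fun setT (EFin \o aff) by apply/measurable_EFinP; exact: measurable_tilt.
have aff0 z : (0 <= (aff z)%:E)%E by rewrite lee_fin tilt_ge0.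
pose e := c2 / (8 * c) * M.
have e8 : 0 <= c2 / (8 * c) by rewrite divr_ge0// mulr_ge0// ltW.
have affinity : (1 <= \int[nu]_z (aff z)%:E + e%:E)%E.
  have -> : (\int[nu]_z (aff z)%:E = \int[nu]_z ((cst 1 z.2 : R) * aff z)%:E)%E.
    by apply: eq_integral => z _; rewrite mul1r.
  rewrite integral_tilt//.
  have mexp : measurable_fun setT
      (fun x => ((cst 1 x : R) * expR ((psi (th x / 2) + Ka x) / c))%:E).
    apply/measurable_EFinP; apply: measurable_funM => //.
    apply: (measurableT_comp (@measurable_expR R)); apply: measurable_funM => //.
    apply: measurable_funD => //.
    exact: (measurableT_comp (measurable_glm_psi m)).
  apply: (@le_trans _ _ (\int[glm_fx m]_x ((cst 1 x * expR ((psi (th x / 2) + Ka x) / c))%:E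
     + (c2 / (8 * c))%:E * (th x ^+ 2)%:E))%E).
    apply: (@le_trans _ _ (\int[glm_fx m]_x 1)%E).
      by rewrite integral_cst// mul1e [leRHS]probability_setT.
    apply: ge0_le_integral => //.
    - by apply: emeasurable_funD => //; apply: measurable_funeM; exact/measurable_EFinP.
    - move=> x _; rewrite -EFinM -EFinD lee_fin /= mul1r.
      apply: (@le_trans _ _ (1 + (psi (th x / 2) + Ka x) / c + c2 / (8 * c) * th x ^+ 2)); last first.
        by rewrite lerD2r expR_ge1Dx.
      rewrite -addrA lerDl (_ : _ / c + _ = (psi (th x / 2) + Ka x + c2 / 8 * th x ^+ 2) / c); last by field.
      rewrite divr_ge0 ?(ltW cp)// /Ka; have := psi_c2 (th x / 2).
      rewrite (_ : 2 * (th x / 2) = th x); last by field.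
      rewrite expr_div_n; lra.
  rewrite ge0_integralD//; last 3 first.
  - by move=> x _; rewrite lee_fin mul1r expR_ge0.
  - by move=> x _; rewrite -EFinM lee_fin mulr_ge0// sqr_ge0.
  - by apply: measurable_funeM; exact/measurable_EFinP.
  rewrite leeD2l// ge0_integralZl_EFin//; last 2 first.
  - by move=> x _; rewrite lee_fin sqr_ge0.
  - exact/measurable_EFinP.
  by rewrite /e [leRHS]EFinM lee_wpmul2l.
have p0 b' z : 0 <= glm_density m b' z by exact: glm_density_ge0.
have mp b' : measurable_fun setT (glm_density m b') by exact: measurable_glm_density.
have mpE b' : measurable_fun setT (EFin \o glm_density m b') by exact/measurable_EFinP.
have p1 b' : (\int[nu]_z (glm_density m b' z)%:E = 1)%E by exact: (probability_setT (glm_law m b')).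
pose a := K * (l / 2 + l^-1).
have a0 : 0 <= a by rewrite mulr_ge0// addr_ge0 ?divr_ge0 ?invr_ge0// ltW.
have Kl0 : 0 <= K * l by rewrite mulr_ge0// ltW.
have k0 b' z : (0 <= (k z * glm_density m b' z)%:E)%E.
  by rewrite lee_fin mulr_ge0//; have /andP[] := kK z.
have mkp b' : measurable_fun setT (fun z => (k z * glm_density m b' z)%:E).
  by apply/measurable_EFinP; exact: measurable_funM.
have pointwise z : k z * glm_density m b z + K * l * aff z <=
    k z * glm_density m zero_vec z + (a * glm_density m b z + a * glm_density m zero_vec z).
  rewrite /aff /tilt /glm_density dotv0 mulr0 sub0r /Ka -/(th z.2).
  set h := glm_h m _ _; set y := z.1; set p := psi (th z.2); set p' := psi 0; set s := th z.2.
  pose u := expR ((y * s - p) / (2 * c)); pose v := expR (- p' / (2 * c)).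
  have -> : expR ((y * s - p) / c) = u ^+ 2.
    by rewrite /u -expRM_natl; congr expR; field.
  have -> : expR (- p' / c) = v ^+ 2 by rewrite /v -expRM_natl; congr expR; field.
  have -> : expR ((y * (s / 2) + - (p + p') / 2) / c) = u * v.
    by rewrite /u /v -expRD; congr expR; field.
  have /andP[kz0 kzK] := kK z.
  have := hellinger_pointwise kz0 kzK l0 (expR_ge0 _ : 0 <= u) (expR_ge0 _ : 0 <= v).
  rewrite -subr_ge0 => /(mulr_ge0 (glm_h_ge0 m y)); rewrite -/h -/a => H.
  rewrite -subr_ge0; apply: (le_trans H); rewrite le_eqVlt; apply/orP; left.
  by apply/eqP; ring.
have main : ((\int[glm_law m b]_z k z)%:E + (K * l)%:E * \int[nu]_z (aff z)%:E <=
    (\int[glm_law m zero_vec]_z k z)%:E + (a%:E + a%:E))%E.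
  have aff0' z : (0 <= (K * l)%:E * (aff z)%:E)%E by rewrite mule_ge0.
  have maff' : measurable_fun setT (fun z => (K * l)%:E * (aff z)%:E)%E.
    exact: measurable_funeM.
  have ap0 b' z : (0 <= a%:E * (glm_density m b' z)%:E)%E by rewrite mule_ge0 ?lee_fin.
  have map b' : measurable_fun setT (fun z => a%:E * (glm_density m b' z)%:E)%E.
    exact: measurable_funeM (mpE b').
  have aE b' : (a%:E = \int[nu]_z (a%:E * (glm_density m b' z)%:E))%E.
    have pE z : [set: record R d] z -> (0 <= (glm_density m b' z)%:E)%E by rewrite lee_fin.
    by rewrite (ge0_integralZl_EFin nu measurableT pE (mpE b') a0) p1 mule1.
  have affE : ((K * l)%:E * \int[nu]_z (aff z)%:E =
      \int[nu]_z ((K * l)%:E * (aff z)%:E))%E 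
    by rewrite (ge0_integralZl_EFin nu measurableT (fun z _ => aff0 z) maff Kl0).
  have lhsE : ((\int[glm_law m b]_z k z)%:E + (K * l)%:E * \int[nu]_z (aff z)%:E =
      \int[nu]_z ((k z * glm_density m b z)%:E + (K * l)%:E * (aff z)%:E))%E.
    by rewrite (EFin_Rintegral_glm_law b mk kK) affE ge0_integralD.
  have aaE : (a%:E + a%:E = \int[nu]_z (a%:E * (glm_density m b z)%:E +
      a%:E * (glm_density m zero_vec z)%:E))%E.
    by rewrite ge0_integralD// -!aE.
  have rhsE : ((\int[glm_law m zero_vec]_z k z)%:E + (a%:E + a%:E) =
      \int[nu]_z ((k z * glm_density m zero_vec z)%:E +
        (a%:E * (glm_density m b z)%:E + a%:E * (glm_density m zero_vec z)%:E)))%E.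
    rewrite (EFin_Rintegral_glm_law zero_vec mk kK) aaE [RHS]ge0_integralD//.
    - by move=> z _; rewrite adde_ge0.
    - exact: emeasurable_funD.
  rewrite [leLHS]lhsE [leRHS]rhsE.
  apply: (ge0_le_integral nu measurableT).
  - by move=> z _; rewrite adde_ge0.
  - exact: emeasurable_funD (mkp b) maff'.
  - exact: emeasurable_funD (mkp zero_vec) (emeasurable_funD (map b) (map zero_vec)).
  - by move=> z _; rewrite -!EFinM -!EFinD lee_fin; exact: pointwise.
have A0 : (0 <= \int[nu]_z (aff z)%:E)%E by apply: integral_ge0.
have target : K * (l * (c2 / (8 * c) * M) + 2 / l) = a + a + K * l * e - K * l.
  by rewrite /a /e; field; rewrite c0 gt_eqF.
by rewrite target; exact: le_of_affinity Kl0 A0 affinity main.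
Qed.

End glm_tilt.

(** * From estimation to testing *)

Section estimation_to_testing.
Context {R : realType} {n d : nat} (m : glm R d).
Variable (M : R.-pker (n.-tuple (record R d)) ~> d.-tuple R).
Implicit Types (b t : d.-tuple R).

Definition sq_ball b (r : R) : set (d.-tuple R) := [set t | sqdist t b < r].

Lemma measurable_sqdist b : measurable_fun setT (fun t => sqdist t b).
Proof.
apply: measurable_sum => i; apply: measurable_funX; apply: measurable_funB => //.
exact: measurable_tnth.
Qed.

Lemma sqdist_ge0 t b : 0 <= sqdist t b.
Proof. by apply: sumr_ge0 => i _; exact: sqr_ge0. Qed.

Lemma measurable_sq_ball b (r : R) : measurable (sq_ball b r).
Proof.
rewrite (_ : sq_ball b r = setT `&` (fun t => sqdist t b) @^-1` `]-oo, r[%classic).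
  by apply: (measurable_sqdist b) => //; exact: measurable_itv.
by rewrite setTI; apply/seteqP; split=> t /=; rewrite in_itv.
Qed.

Definition ball_prob b (r : R) (D : n.-tuple (record R d)) : R :=
  fine (M D (sq_ball b r)).

Lemma kernel_le1 D S : measurable S -> (M D S <= 1)%E.
Proof.
by move=> mS; rewrite -(prob_kernel (s := M) D) le_measure ?inE.
Qed.

Lemma kernel_fin_num D S : measurable S -> M D S \is a fin_num.
Proof.
by move=> mS; rewrite ge0_fin_numE// (le_lt_trans (kernel_le1 D mS))// ltry.
Qed.

Lemma EFin_ball_prob b r D : (ball_prob b r D)%:E = M D (sq_ball b r).
Proof. by rewrite fineK//; apply: kernel_fin_num; exact: measurable_sq_ball. Qed.

Lemma unit_fun_ball_prob b r : unit_fun (ball_prob b r).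
Proof.
split.
  apply: (@measurableT_comp _ _ _ _ _ _ (@fine R)) => //.
  by apply: measurable_kernel; exact: measurable_sq_ball.
move=> D; rewrite -!lee_fin EFin_ball_prob measure_ge0/=.
by apply: kernel_le1; exact: measurable_sq_ball.
Qed.

(** Markov's inequality for the squared distance to [b]. *)
Lemma risk_ge b (r : R) : 0 <= r ->
  ((r * (1 - \int[iid (glm_law m b) n]_D ball_prob b r D))%:E <= risk m M b)%E.
Proof.
move=> r0; have ug := unit_fun_ball_prob b r; have [mg g01] := ug.
have inner D : ((r * (1 - ball_prob b r D))%:E <= \int[M D]_t (sqdist t b)%:E)%E.
  have mb : measurable (~` sq_ball b r) by apply: measurableC; exact: measurable_sq_ball.
  have -> : ((r * (1 - ball_prob b r D))%:E = r%:E * M D (~` sq_ball b r))%E.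
    rewrite EFinM EFinB EFin_ball_prob; congr (_ * _)%E.
    rewrite -(prob_kernel (s := M) D) -(setvU (sq_ball b r)).
    rewrite measureU//; [|exact: measurable_sq_ball|by rewrite setICl].
    by rewrite addeK// kernel_fin_num//; exact: measurable_sq_ball.
  have mi : measurable_fun setT (EFin \o (\1_(~` sq_ball b r) : d.-tuple R -> R)).
    by apply/measurable_EFinP; exact: measurable_indic.
  have i0 t : [set: d.-tuple R] t -> (0 <= (\1_(~` sq_ball b r) t)%:E :> \bar R)%E.
    by rewrite lee_fin.
  rewrite -[in leLHS](setIT (~` _)) -(integral_indic (M D) measurableT mb).
  rewrite -(ge0_integralZl_EFin (M D) measurableT i0 mi r0).
  apply: ge0_le_integral => //.
  - by move=> t _; rewrite -EFinM lee_fin mulr_ge0.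
  - exact: measurable_funeM.
  - by apply/measurable_EFinP; exact: measurable_sqdist.
  - move=> t _; rewrite -EFinM lee_fin indicE.
    have [|] := boolP (t \in ~` sq_ball b r); last by rewrite mulr0 sqdist_ge0.
    by rewrite mulr1 inE => /negP; rewrite -leNgt.
have e : r * (1 - \int[iid (glm_law m b) n]_D ball_prob b r D) =
    \int[iid (glm_law m b) n]_D (- r * (ball_prob b r D + -1)).
  by rewrite Rintegral_affine//; ring.
rewrite e fineK; last first.
  apply: integrable_fin_num => //.
  apply: (bounded_integrable _ (K := r)).
    by apply: measurable_funM => //; exact: measurable_funD.
  move=> D; have /andP[g0 g1] := g01 D.
  by rewrite mulNr -mulrN opprD opprK addrC; apply/andP; split; nra.
rewrite /risk; apply: ge0_le_integral => //.
- move=> D _; have /andP[g0 g1] := g01 D.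
  by rewrite lee_fin mulNr -mulrN opprD opprK addrC; nra.
- apply/measurable_EFinP; apply: measurable_funM => //; exact: measurable_funD.
- apply: (measurable_fun_integral_kernel (l := fun D => M D) _ (k := fun t => (sqdist t b)%:E)).
  + by move=> U mU; exact: measurable_kernel.
  + by move=> t; rewrite lee_fin sqdist_ge0.
  + by apply/measurable_EFinP; exact: measurable_sqdist.
- move=> D _; apply: le_trans (inner D); rewrite lee_fin le_eqVlt; apply/orP; left; apply/eqP; ring.
Qed.

End estimation_to_testing.

Section averaging.
Context {R : realType} {n d : nat} (m : glm R d).
Variable (M : R.-pker (n.-tuple (record R d)) ~> d.-tuple R).
Variables (V : finType) (beta : V -> d.-tuple R) (r k : R).
Hypothesis few : forall t,
  (#|[set v | sqdist t (beta v) < r]%SET|%:R : R) <= #|V|%:R * k.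

(** Each output of the algorithm is close to few vertices only. *)
Lemma sum_ball_prob_le (P : probability (n.-tuple (record R d)) R) :
  \sum_v \int[P]_D ball_prob M (beta v) r D <= #|V|%:R * k.
Proof.
have pointwise D : \sum_v ball_prob M (beta v) r D <= #|V|%:R * k.
  rewrite -lee_fin -sumEFin.
  under eq_bigr do rewrite EFin_ball_prob.
  have mb v : measurable_fun setT (fun t => (\1_(sq_ball (beta v) r) t : R)%:E).
    by apply/measurable_EFinP; apply: measurable_indic; exact: measurable_sq_ball.
  under eq_bigr => v _.
    rewrite -[sq_ball _ _]setIT -(integral_indic (M D) measurableT (measurable_sq_ball _ _)).
    over.
  rewrite -ge0_integral_sum//.
  rewrite -[leRHS]mule1 -(prob_kernel (s := M) D).
  rewrite -integral_cst//; apply: ge0_le_integral => //.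
  - by move=> t _; apply: sume_ge0.
  - exact: emeasurable_sum.
  - move=> t _; rewrite sumEFin lee_fin; apply: le_trans (few t).
    rewrite -sum1_card natr_sum [leRHS]big_mkcond/=; apply: ler_sum => v _.
    rewrite inE indicE; case: ifPn => H; first by rewrite mem_set.
    by rewrite memNset//; exact/negP.
have ug v := unit_fun_ball_prob M (beta v) r.
rewrite -lee_fin -sumEFin; under eq_bigr do rewrite EFin_Rintegral//.
rewrite -ge0_integral_sum//; last 2 first.
- by move=> v; apply/measurable_EFinP; have [] := ug v.
- by move=> v D _; rewrite lee_fin; have [_ /(_ D)/andP[]] := ug v.
rewrite -[leRHS]mule1 -(probability_setT P) -integral_cst//.
apply: ge0_le_integral => //.
- by move=> D _; apply: sume_ge0 => v _; rewrite lee_fin; have [_ /(_ D)/andP[]] := ug v.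
- by apply: emeasurable_sum => v; apply/measurable_EFinP; have [] := ug v.
- by move=> D _; rewrite sumEFin lee_fin.
Qed.

(** Fano's argument: under the null law at most a fraction [k] of the vertices is
    found on average; if passing to the laws of the vertices increases this
    by a controlled amount only, some vertex is missed. *)
Lemma missed_vertex (P : probability (n.-tuple (record R d)) R) (a u eta : R) :
  (0 < #|V|)%N -> 0 <= a -> 0 <= r ->
  (forall v, \int[iid (glm_law m (beta v)) n]_D ball_prob M (beta v) r D
     <= a * \int[P]_D ball_prob M (beta v) r D + u) ->
  a * k + u <= 1 - eta ->
  exists v, ((r * eta)%:E <= risk m M (beta v))%E.
Proof.
move=> V0 a0 r0 chg le_eta.
have [v vP] : exists v,
    \int[iid (glm_law m (beta v)) n]_D ball_prob M (beta v) r D <= 1 - eta.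
  apply: contrapT => /forallNP none.
  have : #|V|%:R * (1 - eta) < #|V|%:R * (a * k + u).
    apply: (@lt_le_trans _ _ (\sum_v
        \int[iid (glm_law m (beta v)) n]_D ball_prob M (beta v) r D)).
      rewrite mulr_natl -sumr_const; apply: ltr_sum => [|v _].
        by have /card_gt0P[v _] := V0; apply/hasP; exists v; rewrite ?mem_index_enum.
      by rewrite ltNge; exact/negP.
    apply: (@le_trans _ _ (\sum_v (a * \int[P]_D ball_prob M (beta v) r D + u))).
      exact: ler_sum.
    rewrite big_split/= -mulr_sumr sumr_const -[u *+ _]mulr_natl mulrDr lerD2r.
    by rewrite mulrCA ler_wpM2l// sum_ball_prob_le.
  by rewrite ltr_pM2l ?ltr0n// ltNge le_eta.
exists v; apply: le_trans (risk_ge m M (beta v) r0).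
by rewrite lee_fin ler_wpM2l// lerBrDl addrC -lerBrDl.
Qed.

End averaging.

(** * The two lower bounds *)

Lemma expR_sub1_le (R : realType) (x : R) : 0 <= x -> x <= 1 -> expR x - 1 <= 4 * x.
Proof.
move=> x0 x1.
have e4 : expR x <= 4.
  have -> : x = 2%:R * (x / 2) by field.
  have -> : (4 : R) = 2 ^+ 2 by rewrite -natrX.
  rewrite expRM_natl lerXn2r ?nnegrE ?expR_ge0//.
  rewrite -[x / 2]opprK expRN invf_ple ?posrE ?expR_gt0//.
  by apply: le_trans (expR_ge1Dx _); lra.
have : expR x * (1 - x) <= 1.
  by rewrite -[leRHS](expRxMexpNx_1 x) ler_wpM2l ?expR_ge0// expR_ge1Dx.
have := expR_ge0 x; nra.
Qed.

Lemma ball_prob_private (R : realType) (n d : nat) (eps delta : R)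
    (M : R.-pker (n.-tuple (record R d)) ~> d.-tuple R) (b : d.-tuple R) (r : R) :
  dp eps delta M -> forall (i : 'I_n) (D D' : n.-tuple (record R d)),
    (forall j, j != i -> tnth D j = tnth D' j) ->
    ball_prob M b r D <= expR eps * ball_prob M b r D' + delta.
Proof.
move=> Mdp i D D' DD'; rewrite -lee_fin EFinD EFinM !EFin_ball_prob.
by apply: Mdp; [exists i|exact: measurable_sq_ball].
Qed.

Section lower_bounds.
Context {R : realType} {n d s : nat} (m : glm R d) (C c2 : R).
Hypotheses (n0 : (0 < n)%N) (s2 : (2 <= s)%N) (sd : (2 * s <= d)%N).
Hypotheses (gram : glm_gram_exists m) (gramC : lambda_max (glm_gram m) <= C).
Hypothesis psi2 : forall t : R, `|derive1n 2 (glm_psi m) t| <= c2.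
Variable (M : R.-pker (n.-tuple (record R d)) ~> d.-tuple R).
Local Notation c := (glm_scale m).
Local Notation H := (entropy d s : R).
Local Notation q := (d %/ s)%N.
Local Notation P0 := (iid (glm_law m zero_vec) n).

Let L : R := s%:R * ln q%:R.
Let s0 : (0 < s)%N. Proof. exact: ltnW. Qed.
Let q2 : (2 <= q)%N. Proof. by rewrite leq_divRL. Qed.
Let sq_d : (s * q <= d)%N. Proof. by rewrite mulnC leq_divM. Qed.
Let V : finType := {ffun 'I_s -> 'I_q}.
Let V0 : (0 < #|V|)%N.
Proof. by rewrite card_ffun !card_ord expn_gt0 (ltnW q2). Qed.
Let beta (rho : R) (v : V) : d.-tuple R := cube_vertex sq_d rho v.
Let a : R := `|c2| * `|C|.
Let a0 : 0 <= a. Proof. by rewrite mulr_ge0. Qed.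

(** In both regimes some vertex is missed with probability at least [gap]. The
    leading term is [expR (- (L / 24))], and [L >= 2 * ln 2]; half of what remains
    below [1] is left for the additive errors. *)
Definition gap : R := (1 - expR (- (ln 2 / 12))) / 2.

Lemma ln2_gt0 : 0 < ln 2 :> R. Proof. by rewrite ln_gt0// ltr1n. Qed.

Lemma gap_gt0 : 0 < gap.
Proof. by rewrite divr_gt0// subr_gt0 expR_lt1 oppr_lt0 divr_gt0// ln2_gt0. Qed.

Lemma gap_lt1 : gap < 1.
Proof. by rewrite /gap; have := expR_gt0 (- (ln 2 / 12) : R); lra. Qed.

Let L_ge : 2 * ln 2 <= L.
Proof.
rewrite /L ler_pM ?ler_nat// ?(ltW ln2_gt0)//.
by rewrite ler_ln ?posrE ?ltr0n ?ler_nat// (ltnW q2).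
Qed.
Let L_gt0 : 0 < L. Proof. by have := ln2_gt0; have := L_ge; lra. Qed.

Let expL : expR (- (L / 24)) <= 1 - 2 * gap.
Proof.
rewrite /gap (_ : 1 - _ = expR (- (ln 2 / 12))); last by field.
by rewrite ler_expR; have := L_ge; lra.
Qed.

Let HL : H <= 4 * L. Proof. exact: entropy_le. Qed.

Lemma entropy_gt0 : 0 < H.
Proof.
rewrite mulr_gt0 ?ltr0n// ln_gt0//.
have d1 : 1 <= d%:R / s%:R :> R.
  rewrite ler_pdivlMr ?ltr0n// mul1r ler_nat (leq_trans _ sd)//.
  by rewrite leq_pmull.
rewrite -mulrA; apply: (lt_le_trans (_ : 1 < expR 1)).
  by rewrite expR_gt1.
by rewrite ler_peMr ?expR_ge0.
Qed.

Let c2_ge0 : 0 <= c2. Proof. exact: le_trans (psi2 0). Qed.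

Let psi_c2 u : glm_psi m (2 * u) - 2 * glm_psi m u + glm_psi m 0 <= c2 * u ^+ 2.
Proof.
have dpsi (t : R) : is_derive t (1 : R) (glm_psi m) (derive1 (glm_psi m) t).
  by apply: DeriveDef; [exact: glm_psi_derivable|rewrite derive1E].
have ddpsi (t : R) :
    is_derive t (1 : R) (derive1 (glm_psi m)) (derive1n 2 (glm_psi m) t).
  by apply: DeriveDef; [exact: glm_dpsi_derivable|rewrite /= derive1E].
exact: (second_difference_le dpsi ddpsi psi2).
Qed.

Let moment2 rho v :
  (\int[glm_fx m]_x ((dotv x (beta rho v)) ^+ 2)%:E <= (`|C| * rho ^+ 2)%:E)%E.
Proof.
apply: le_trans (integral_dotv_sqr_le _ gram) _.
rewrite sum_cube_vertex_sqr// lee_fin ler_wpM2r ?sqr_ge0//.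
exact: le_trans (ler_norm _).
Qed.

Let few rho t : 0 < rho ->
  (#|[set v | sqdist t (beta rho v) < rho ^+ 2 / 24]%SET|%:R : R)
    <= #|V|%:R * expR (- (L / 6)).
Proof. by move=> rho0; exact: card_cube_ball. Qed.

(** Small enough that the accumulated weights exceed [L / 24] with probability at
    most [gap]: that probability is at most [48 * a * kappa_fano], since
    [H <= 4 * L]. *)
Definition kappa_fano : R := gap / (48 * a + 1).

Lemma fano_risk (rho : R) : 0 < rho -> rho ^+ 2 = kappa_fano * (c * (H / n%:R)) ->
  exists v, ((rho ^+ 2 / 24 * gap)%:E <= risk m M (beta rho v))%E.
Proof.
move=> rho0 rhoE; pose l := expR (- (L / 12)).
(* The square root of the null probability is linearized at l, the square root of
   the bound on its average over the vertices; averages can then be compared. *)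
have l0 : 0 < l by exact: expR_gt0.
apply: (@missed_vertex R n d m M V (beta rho) _ _ (fun t => @few rho t rho0) P0
  (expR (L / 24) * (2 * l)^-1) (expR (L / 24) * (l / 2) + gap) gap V0).
- by rewrite mulr_ge0 ?expR_ge0// invr_ge0 mulr_ge0// ltW.
- by rewrite divr_ge0// sqr_ge0.
- move=> v; set g := ball_prob _ _ _.
  have ug : unit_fun g by exact: unit_fun_ball_prob.
  have L24 : 0 < L / 24 by rewrite divr_gt0.
  have chg := weighted_l2_change_of_law (measurable_glm_weight m c2 (beta rho v))
    (glm_weight_ge0 m (beta rho v) c2_ge0) (glm_weighted_l2 (beta rho v) c2_ge0 psi_c2)
    ug L24 (integral_glm_weight_le c2_ge0 (moment2 rho v)).
  apply: (le_trans chg); set G0 := \int[P0]_D g D.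
  have G00 : 0 <= G0 by have /andP[] := Rintegral_unit P0 ug.
  rewrite [leRHS](_ : _ = expR (L / 24) * ((2 * l)^-1 * G0 + l / 2) + gap); last by ring.
  apply: lerD.
    apply: ler_wpM2l; first exact: expR_ge0.
    rewrite -subr_ge0.
    rewrite (_ : _ - _ = (Num.sqrt G0 - l) ^+ 2 / (2 * l)).
      by rewrite divr_ge0 ?sqr_ge0// mulr_ge0// ltW.
    by rewrite -{1}(sqr_sqrtr G00); field; rewrite gt_eqF.
  have c0 : c != 0 by rewrite gt_eqF// scale_gt0.
  have nn : n%:R != 0 :> R by rewrite pnatr_eq0 -lt0n.
  have Ln : L != 0 by rewrite gt_eqF.
  have den : 0 < 48 * a + 1 by rewrite ltr_wpDl// mulr_ge0.
  have -> : n%:R * (c2 / (2 * c) * (`|C| * rho ^+ 2)) / (L / 24) =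
      gap * (12 * a * (H / L)) / (48 * a + 1).
    rewrite rhoE /kappa_fano /a (ger0_norm c2_ge0); field.
    by rewrite nn c0 Ln gt_eqF//; move: den; rewrite /a (ger0_norm c2_ge0).
  rewrite ler_pdivrMr// ler_wpM2l ?(ltW gap_gt0)//.
  have : H / L <= 4 by rewrite ler_pdivrMr.
  move=> /(ler_wpM2l a0); lra.
- have -> : expR (L / 24) * (2 * l)^-1 * expR (- (L / 6)) = expR (- (L / 24)) / 2.
    rewrite invfM -/l /l -expRN opprK mulrCA -mulrA -!expRD mulrC.
    by congr (expR _ / _); lra.
  have -> : expR (L / 24) * (l / 2) = expR (- (L / 24)) / 2.
    by rewrite mulrA -expRD; congr (expR _ / _); lra.
  by have := expL; lra.
Qed.

(** [a / 8 + 2] bounds the total variation distance per unit of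
    [rho / sqrt c], so that [n eps t = (gap / 128) * H / sqrt (log_en n)]. *)
Definition kappa_private : R := (gap / 128 / (a / 8 + 2)) ^+ 2.

Lemma private_risk (rho eps delta : R) :
  dp eps delta M -> 0 < eps -> eps <= 1 -> 0 <= delta ->
  delta <= eps * expR (- 2 * H / Num.sqrt (log_en n)) ->
  0 < rho ->
  rho ^+ 2 = kappa_private * (c * (H ^+ 2 / (log_en n * n%:R ^+ 2 * eps ^+ 2))) ->
  exists v, ((rho ^+ 2 / 24 * gap)%:E <= risk m M (beta rho v))%E.
Proof.
move=> Mdp eps0 eps1 delta0 deltaE rho0 rhoE.
have c0 : 0 < c := scale_gt0 m.
have nR : 0 < n%:R :> R by rewrite ltr0n.
have ell1 : 1 <= log_en n :> R.
  rewrite /log_en -[leLHS](expRK 1) ler_ln ?posrE ?mulr_gt0 ?expR_gt0//.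
  by rewrite ler_peMr ?expR_ge0// ler1n.
pose w : R := Num.sqrt (log_en n).
have w1 : 1 <= w by rewrite -sqrtr1 ler_wsqrtr.
have w0 : 0 < w by exact: lt_le_trans w1.
pose x := H / w.
have x0 : 0 < x by rewrite divr_gt0// entropy_gt0.
have xH : x <= H by rewrite ler_pdivrMr// ler_peMr// ltW// entropy_gt0.
pose tau := gap / 128.
have tau0 : 0 < tau by rewrite divr_gt0// gap_gt0.
pose K := a / 8 + 2.
have K0 : 0 < K by rewrite ltr_wpDl// divr_ge0.
pose rc := rho / Num.sqrt c.
have sc0 : 0 < Num.sqrt c by rewrite sqrtr_gt0.
have rc0 : 0 < rc by rewrite divr_gt0.
have rcE : rc = tau / K * (x / (n%:R * eps)).
  apply/eqP; rewrite -(@eqrXn2 _ 2)//; last 2 first.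
  - exact: ltW.
  - by apply: ltW; apply: mulr_gt0; apply: divr_gt0 => //; exact: mulr_gt0.
  rewrite /rc expr_div_n (sqr_sqrtr (ltW c0)) rhoE /kappa_private -/tau -/K /x.
  have -> : log_en n = w ^+ 2 by rewrite sqr_sqrtr// (le_trans ler01).
  by apply/eqP; field; rewrite !gt_eqF.
pose t := K * rc.
have tE : t = tau * x / (n%:R * eps).
  by rewrite /t rcE; field; rewrite !gt_eqF.
have t0 : 0 <= t by rewrite mulr_ge0// ltW.
have nte : n%:R * t * eps = tau * x by rewrite tE; field; rewrite !gt_eqF.
have nt : n%:R * t = tau * x / eps by rewrite tE; field; rewrite !gt_eqF.
have tv v : tv_le (glm_law m (beta rho v)) (glm_law m zero_vec) t.
  (* The parameter of glm_tv_le balancing its two terms. *)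
  have l0 : 0 < rc^-1 by rewrite invr_gt0.
  have -> : t = rc^-1 * (c2 / (8 * c) * (`|C| * rho ^+ 2)) + 2 / rc^-1.
    have -> : rho ^+ 2 = rc ^+ 2 * c.
      by rewrite /rc expr_div_n (sqr_sqrtr (ltW c0)) divfK// gt_eqF.
    by rewrite /t /K /a (ger0_norm c2_ge0); field; rewrite !gt_eqF.
  exact: (glm_tv_le c2_ge0 psi_c2 (moment2 rho v) l0).
pose A := (1 + (expR eps - 1) * t) ^+ n.
have e1 : 1 <= expR eps by rewrite -expR0 ler_expR ltW.
have A0 : 0 <= A by rewrite exprn_ge0// addr_ge0// mulr_ge0// subr_ge0.
have AE : A <= expR (4 * tau * x).
  have -> : 4 * tau * x = n%:R * (4 * eps * t).
    by rewrite -mulrA -nte; ring.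
  rewrite expRM_natl /A lerXn2r ?nnegrE ?expR_ge0//.
    by rewrite addr_ge0// mulr_ge0// subr_ge0.
  apply: le_trans (expR_ge1Dx _); rewrite lerD2l ler_wpM2r//.
  exact: expR_sub1_le (ltW eps0) eps1.
have tau1 : tau <= 1 / 128 by rewrite /tau; have := gap_lt1; lra.
apply: (@missed_vertex R n d m M V (beta rho) _ _ (fun t => @few rho t rho0) P0
  A (A * (n%:R * t * delta)) gap V0 A0).
- by rewrite divr_ge0// sqr_ge0.
- move=> v; rewrite -mulrDr.
  apply: tv_private_iid => //; first exact: unit_fun_ball_prob.
  exact: ball_prob_private.
- have first_le : A * expR (- (L / 6)) <= 1 - 2 * gap.
    apply: le_trans expL; apply: (@le_trans _ _ (expR (4 * tau * x) * expR (- (L / 6)))).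
      by rewrite ler_wpM2r ?expR_ge0.
    rewrite -expRD ler_expR.
    have : tau * x <= 1 / 128 * (4 * L).
      by apply: ler_pM => //; [exact: ltW|exact: ltW|exact: le_trans xH HL].
    lra.
  have dx : delta / eps <= expR (- (2 * x)).
    rewrite ler_pdivrMr// mulrC (le_trans deltaE)// ler_wpM2l ?(ltW eps0)//.
    by rewrite ler_expR -/w (_ : - 2 * H / w = - (2 * x))// /x; ring.
  have xexp : x * expR (- x) <= 1.
    rewrite expRN ler_pdivrMr ?expR_gt0// mul1r.
    by apply: le_trans (expR_ge1Dx x); rewrite lerDr.
  have second_le : A * (n%:R * t * delta) <= gap.
    apply: (@le_trans _ _ (expR (4 * tau * x) * (tau * x * expR (- (2 * x))))).
      apply: ler_pM => //; first by apply: mulr_ge0 => //; apply: mulr_ge0.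
      rewrite nt -mulrA [eps^-1 * _]mulrC; apply: ler_wpM2l => //.
      by apply: mulr_ge0; exact: ltW.
    rewrite mulrCA -expRD; apply: (@le_trans _ _ (tau * x * expR (- x))).
      apply: ler_wpM2l; first by apply: mulr_ge0; exact: ltW.
      rewrite ler_expR.
      by have := ler_wpM2r (ltW x0) tau1; lra.
    rewrite -mulrA; apply: (@le_trans _ _ tau).
      by rewrite ler_piMr// ltW.
    by rewrite /tau; have := gap_gt0; lra.
  lra.
Qed.

End lower_bounds.

Lemma kappa_fano_gt0 (R : realType) (C c2 : R) : 0 < kappa_fano C c2.
Proof. by rewrite divr_gt0 ?gap_gt0// ltr_wpDl// !mulr_ge0. Qed.

Lemma kappa_fano_le1 (R : realType) (C c2 : R) : kappa_fano C c2 <= 1.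
Proof.
have a0 : 0 <= 48 * (`|c2| * `|C|) by rewrite !mulr_ge0.
rewrite /kappa_fano ler_pdivrMr ?mul1r; last by rewrite ltr_wpDl.
by have := @gap_lt1 R; lra.
Qed.

Lemma kappa_private_gt0 (R : realType) (C c2 : R) : 0 < kappa_private C c2.
Proof.
have a0 : 0 <= `|c2| * `|C| by rewrite !mulr_ge0.
apply: exprn_gt0; apply: divr_gt0; last by lra.
by rewrite divr_gt0// gap_gt0.
Qed.

Lemma kappa_private_le1 (R : realType) (C c2 : R) : kappa_private C c2 <= 1.
Proof.
have a0 : 0 <= `|c2| * `|C| by rewrite !mulr_ge0.
have den : 0 < `|c2| * `|C| / 8 + 2 by lra.
rewrite expr_le1//.
  by rewrite ler_pdivrMr// mul1r; have := @gap_lt1 R; lra.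
by apply: divr_ge0; [rewrite divr_ge0// ltW// gap_gt0|exact: ltW].
Qed.

Theorem theorem5p1 (R : realType) (C c2 : R) :
  exists c0 c1 c2' : R, [/\ 0 < c0, 0 < c1, 0 < c2' &
  forall clo chi : R, 0 < clo ->
  exists c : R, 0 < c /\
  forall (n d s : nat) (m : glm R d) (B eps delta : R),
    (0 < n)%N ->
    0 < B ->
    (2 <= s)%N -> (2 * s <= d)%N ->
    clo <= glm_scale m -> glm_scale m <= chi ->
    glm_gram_exists m -> lambda_max (glm_gram m) <= C ->
    (forall t : R, `|derive1n 2 (glm_psi m) t| <= c2) ->
    0 < eps -> eps <= 1 ->
    0 <= delta ->
    delta <= c0 * eps * expR (- c1 * entropy d s / Num.sqrt (log_en n)) ->
    glm_scale m * dp_rate n d s eps <= c2' * B ^+ 2 ->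
    ((c * glm_scale m * dp_rate n d s eps)%:E
      <= minimax_risk n m eps delta (sparse_ball s B))%E].
Proof.
exists 1, 2, 1; split=> // clo chi _.
set kf := kappa_fano C c2; set kp := kappa_private C c2.
have kf0 : 0 < kf := kappa_fano_gt0 C c2.
have kp0 : 0 < kp := kappa_private_gt0 C c2.
have kf1 : kf <= 1 := kappa_fano_le1 C c2.
have kp1 : kp <= 1 := kappa_private_le1 C c2.
have g0 : 0 < (gap : R) := @gap_gt0 R.
pose k := Num.min kf kp.
have k0 : 0 < k by rewrite lt_min kf0.
exists (k * (gap : R) / 48); split; first by rewrite divr_gt0// mulr_gt0.
move=> n d s m B eps delta n0 B0 s2 sd _ _ gram gramC psi2 eps0 eps1 delta0.
rewrite !mul1r => deltaE rateB.
have c0 : 0 < glm_scale m := scale_gt0 m.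
have nR : 0 < n%:R :> R by rewrite ltr0n.
have H0 : 0 < entropy d s :> R by exact: entropy_gt0.
have ell0 : 0 < log_en n :> R.
  rewrite ln_gt0// (lt_le_trans (_ : 1 < expR 1)) ?expR_gt1//.
  by rewrite ler_peMr ?expR_ge0// ler1n.
pose T1 := entropy d s / n%:R : R.
pose T2 := entropy d s ^+ 2 / (log_en n * n%:R ^+ 2 * eps ^+ 2) : R.
have T10 : 0 < T1 by rewrite divr_gt0.
have T20 : 0 < T2 by rewrite divr_gt0 ?exprn_gt0// !mulr_gt0// exprn_gt0.
have rateE : dp_rate n d s eps = T1 + T2 by [].
(* Each term T is treated when it is the larger one, hence at least half of the
   rate; since kap <= 1 and c2' = 1, the norm rho of the vertices is then at
   most B. *)
have bound (kap T : R) : 0 < kap -> kap <= 1 -> k <= kap -> 0 < T ->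
    T <= T1 + T2 -> T1 + T2 <= 2 * T ->
    (forall M, dp eps delta M -> forall rho : R, 0 < rho ->
      rho ^+ 2 = kap * (glm_scale m * T) ->
      exists2 b, sparse_ball s rho b & ((rho ^+ 2 / 24 * (gap : R))%:E <= risk (n := n) m M b)%E) ->
    ((k * (gap : R) / 48 * glm_scale m * dp_rate n d s eps)%:E
      <= minimax_risk n m eps delta (sparse_ball s B))%E.
  move=> kap0 kap1 kkap T0 Tle leT hard.
  pose rho := Num.sqrt (kap * (glm_scale m * T)).
  have r0 : 0 < kap * (glm_scale m * T) by rewrite !mulr_gt0.
  have rhoE : rho ^+ 2 = kap * (glm_scale m * T) by rewrite sqr_sqrtr// ltW.
  have rho0 : 0 < rho by rewrite sqrtr_gt0.
  have cT0 : 0 <= glm_scale m * T by rewrite mulr_ge0 ?ltW.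
  have rhoB : rho <= B.
    rewrite -(@ler_pXn2r _ 2)// ?nnegrE ?(ltW rho0) ?(ltW B0)//.
    apply: le_trans rateB; rewrite rhoE rateE.
    apply: (@le_trans _ _ (glm_scale m * T)); first by rewrite ler_piMl.
    by rewrite ler_wpM2l// ltW.
  apply: le_ereal_inf_tmp => _ [M Mdp <-].
  have [b [b0 bB] brisk] := hard M Mdp rho rho0 rhoE.
  apply: le_ereal_sup_tmp; exists (risk m M b).
    by exists b => //; split=> //; exact: le_trans rhoB.
  apply: le_trans brisk; rewrite lee_fin rateE rhoE.
  apply: (@le_trans _ _ (k * (gap : R) / 48 * glm_scale m * (2 * T))).
    by rewrite ler_wpM2l// mulr_ge0 ?ltW// divr_gt0// mulr_gt0.
  rewrite (_ : _ * (2 * T) = k * ((gap : R) / 24 * (glm_scale m * T))); last by field.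
  rewrite (_ : _ / 24 * (gap : R) = kap * ((gap : R) / 24 * (glm_scale m * T))); last by field.
  by rewrite ler_wpM2r// mulr_ge0// divr_ge0// ltW.
have vertex rho (v : {ffun 'I_s -> 'I_(d %/ s)}) (sq : (s * (d %/ s) <= d)%N) :
    0 < rho -> sparse_ball s rho (cube_vertex sq rho v).
  move=> rho0; split; first exact: l0norm_cube_vertex.
  by rewrite l2norm_cube_vertex ?(ltW rho0)// ltnW.
have [T21|/ltW T12] := leP T2 T1.
  apply: (bound kf T1) => //; [by rewrite ge_min lexx|lra|lra|].
  move=> M Mdp rho rho0 rhoE.
  have [v rv] := fano_risk n0 s2 sd gram gramC psi2 M rho0 rhoE.
  by eexists; last exact: rv; exact: vertex.
apply: (bound kp T2) => //; [by rewrite ge_min lexx orbT|lra|lra|].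
move=> M Mdp rho rho0 rhoE.
have [v rv] := private_risk n0 s2 sd gram gramC psi2 Mdp eps0 eps1 delta0 deltaE rho0 rhoE.
by eexists; last exact: rv; exact: vertex.
Qed.
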